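(* Let $L\ge0$, $\eta>0$ and let $0<x_{L,\eta,1}<x_{L,\eta,2}<\ldots$ denote the positive zeros of $F_L(\eta,\cdot)$. For every $n\ge1$, let $a_{L,\eta,n}$ be the unique critical point of $\Psi_{L,\eta}$ in $(x_{L,\eta,n},x_{L,\eta,n+1})$ and define $b_{L,\eta,n}=\Psi_{L,\eta}(a_{L,\eta,n})$. Then the sequence $\{b_{L,\eta,n}\}_{n\ge1}$ satisfies $$0<b_{L,\eta,1}<b_{L,\eta,2}<\ldots<b_{L,\eta,n}<b_{L,\eta,n+1}<\ldots<1\qquad\text{and}\qquad\lim_{n\to\infty}b_{L,\eta,n}=1.$$ Consequently, with the notation $F_L=F_L(\eta,\rho)$, $F_L'=\frac{\partial}{\partial\rho}F_L(\eta,\rho)$ and $$\Delta_{L,\eta}^C(\rho)=\left(L(L+1)+\eta^2\right)F_L^2-\sqrt{(L^2+\eta^2)((L+1)^2+\eta^2)}\,F_{L-1}F_{L+1}+\eta\left(\frac{F_L^2}{\rho}-F_LF_L'\right),$$ the following sharp Turán type inequalities hold: $$\Delta_{L,\eta}^C(\rho)=L(L+1)\Psi_{L,\eta}(\rho)\left(F_L(\eta,\rho)\right)^2\ge L(L+1)\,b_{L,\eta,n}\left(F_L(\eta,\rho)\right)^2,$$ where $x_{L,\eta,n}<\rho<x_{L,\eta,n+1}$, and equality holds exactly at the points $\rho=a_{L,\eta,n}$. Moreover, the sharp constants $L(L+1)b_{L,\eta,n}$ increase to $L(L+1)$ as $n\to\infty$.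
   Context: $F_L(\eta,\rho)$ ($\rho>0$) denotes the regular Coulomb wave function: the standard solution of the Coulomb wave equation $$w''(\rho)+\left(1-\frac{2\eta}{\rho}-\frac{L(L+1)}{\rho^2}\right)w(\rho)=0,\qquad \rho>0,$$ with regular behavior at the origin and the usual normalization $F_L(\eta,\rho)\sim C_L(\eta)\rho^{L+1}$ as $\rho\searrow0$, where $$C_L(\eta)=\frac{2^Le^{-\pi\eta/2}|\Gamma(L+1+\mathrm i\eta)|}{\Gamma(2L+2)}>0.$$ $F_{L-1}$ and $F_{L+1}$ are the regular Coulomb wave functions with $L$ replaced by $L-1$ and $L+1$ and the same $\eta$ and $\rho$. Primes denote derivatives in $\rho$. Put $\nu=L+\frac12$ and, where $F_L(\eta,\rho)\ne0$, $$y_{L,\eta}(\rho)=\frac{\rho F_L'(\eta,\rho)}{F_L(\eta,\rho)}-\frac12,\qquad \Psi_{L,\eta}(\rho)=1-\frac{2\eta}{\rho}+\frac{y_{L,\eta}^2(\rho)-\nu^2}{\rho^2}.$$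
   Formalization: For L=0 both sides of the Turán inequality vanish identically, so equality holds everywhere and the constants L(L+1)b_n are all 0; ''equality exactly at a_n'' and strict increase of the constants are claimed only for L>0 (F_{-1} is read as the limit F_0). *)

(* Defs.v *)
From Stdlib Require Import Reals Factorial Lra Lia.
From Coquelicot Require Import Coquelicot.

Open Scope R_scope.

Definition Cpower (t : R) (z : C) : C :=
  (exp (Re z * ln t) * cos (Im z * ln t), exp (Re z * ln t) * sin (Im z * ln t)).

(* z (z+1) ... (z+n), with n+1 factors *)
Fixpoint Crising (z : C) (n : nat) : C :=
  match n with
  | O => z
  | S m => (Crising z m * (z + RtoC (INR (S m))))%C
  end.

Definition gauss_seq (z : C) (n : nat) : C :=
  (RtoC (INR (fact n)) * Cpower (INR n) z / Crising z n)%C.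

(* Gauss's limit, valid for every z that is not a pole 0, -1, -2, ... *)
Definition Cgamma (z : C) : C :=
  (real (Lim_seq (fun n => Re (gauss_seq z n))),
   real (Lim_seq (fun n => Im (gauss_seq z n)))).

Definition coulombC (L eta : R) : R :=
  Rpower 2 L * exp (- (PI * eta / 2)) * Cmod (Cgamma (L + 1, eta))
  / Re (Cgamma (RtoC (2 * L + 2))).

(* For L > -1.  For L >= -1/2 the normalization alone singles out one solution;
   for -1 < L < -1/2 the second solution, of order rho^(-L), is o(rho^(L+1)) and
   only the regularity clause (rho^(-L-1) F is an entire power series) excludes
   it.  That range occurs as the lower neighbour of 0 < L < 1/2. *)
Record coulomb_solution (L eta : R) (F : R -> R) : Prop := {
  coulomb_ode : forall rho, 0 < rho ->
    ex_derive F rho /\ ex_derive (Derive F) rho /\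
    Derive_n F 2 rho + (1 - 2 * eta / rho - L * (L + 1) / rho ^ 2) * F rho = 0;
  coulomb_regular : exists c : nat -> R, forall rho, 0 < rho ->
    is_pseries c rho (F rho / Rpower rho (L + 1));
  coulomb_normalized :
    filterlim (fun rho => F rho / Rpower rho (L + 1))
              (at_right 0) (locally (coulombC L eta))
}.

(* "F is F_L(eta, .)" for L >= -1; values at rho <= 0 are irrelevant.  At L = -1
   the equation is that of L = 0 and C_L(eta) vanishes in the limit, so the
   normalization degenerates; there F_(-1) means the limit of F_L as L -> -1.
   Since F_L = C_L rho^(L+1) (1 + eta rho / (L+1) + ...) and, for eta > 0,
   C_L eta / (L+1) -> C_0, this limit is F_0. *)
Definition regular_coulomb (L eta : R) (F : R -> R) : Prop :=
  if Req_EM_T L (-1) then coulomb_solution 0 eta F else coulomb_solution L eta F.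

Definition coulomb_y (F : R -> R) (rho : R) : R :=
  rho * Derive F rho / F rho - 1 / 2.

Definition coulomb_Psi (L eta : R) (F : R -> R) (rho : R) : R :=
  1 - 2 * eta / rho + (coulomb_y F rho ^ 2 - (L + 1 / 2) ^ 2) / rho ^ 2.

(* Fm, F, Fp stand for the functions of index L-1, L, L+1. *)
Definition turan_coulomb (L eta : R) (Fm F Fp : R -> R) (rho : R) : R :=
  (L * (L + 1) + eta ^ 2) * F rho ^ 2
  - sqrt ((L ^ 2 + eta ^ 2) * ((L + 1) ^ 2 + eta ^ 2)) * Fm rho * Fp rho
  + eta * (F rho ^ 2 / rho - F rho * Derive F rho).

(* Indices start at 1; x 0 is unconstrained. *)
Definition positive_zeros (F : R -> R) (x : nat -> R) : Prop :=
  (forall n, (1 <= n)%nat -> 0 < x n < x (S n)) /\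
  (forall rho, 0 < rho -> F rho = 0 <-> exists n, (1 <= n)%nat /\ x n = rho).

(* Existence of F_L(eta, .) for every L >= -1, from the power series
   c_0 = C_L(eta), (n+1)(n+2L+2) c_(n+1) = 2 eta c_n - c_(n-1), c_(-1) = 0;
   coulomb_coef2 returns the pair (c_(n-1), c_n). *)
Fixpoint coulomb_coef2 (L eta c0 : R) (n : nat) : R * R :=
  match n with
  | O => (0, c0)
  | S m => let p := coulomb_coef2 L eta c0 m in
      (snd p, (2 * eta * snd p - fst p) / (INR (S m) * (INR m + 2 * L + 2)))
  end.
Definition coulomb_coef L eta c0 n := snd (coulomb_coef2 L eta c0 n).

Lemma coulomb_coef_bound (L eta c0 : R) : -1 < L ->
  exists M A, 1 <= A /\ 0 <= M /\ forall n, 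
    Rabs (coulomb_coef L eta c0 n) <= M * A ^ n / INR (fact n).
Proof.
intros hL. set (A := 4 * Rabs eta + 2 + 1/(2*L+2)).
assert (hd : 0 < 1 / (2 * L + 2)) by (apply Rdiv_lt_0_compat; lra).
assert (he := Rabs_pos eta).
exists (Rabs c0), (A * (2 * Rabs eta + 2)).
assert (hA : 2 <= A * (2 * Rabs eta + 2)) by (unfold A; nra).
set (B := A * (2 * Rabs eta + 2)) in *.
assert (hM := Rabs_pos c0).
split; [lra|split;[exact hM|]].
enough (H : forall n, Rabs (fst (coulomb_coef2 L eta c0 n)) <= Rabs c0 * B ^ n / INR (fact n) * (INR n / B) /\
   Rabs (coulomb_coef L eta c0 n) <= Rabs c0 * B ^ n / INR (fact n)) by (intros n; apply (H n)).
intros n; induction n as [|n [IH1 IH2]].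
- simpl. rewrite Rabs_R0. unfold coulomb_coef; simpl. split; [unfold Rdiv; nra|lra].
- unfold coulomb_coef in *. change (coulomb_coef2 L eta c0 (S n)) with
    (let p := coulomb_coef2 L eta c0 n in
     (snd p, (2 * eta * snd p - fst p) / (INR (S n) * (INR n + 2 * L + 2)))).
  cbv zeta; cbn [fst snd].
  set (u := snd _) in *. set (v := fst _) in *.
  rewrite fact_simpl, mult_INR. set (f := INR (fact n)) in *.
  assert (hf : 0 < f) by apply INR_fact_lt_0.
  assert (hn := pos_INR n). 
  assert (hB : 0 < B ^ n) by (apply pow_lt; lra).
  set (K := Rabs c0 * B ^ n / f) in *.
  assert (hK : 0 <= K) by (apply Rdiv_le_0_compat; nra).
  rewrite !S_INR. change (B ^ S n) with (B * B ^ n).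
  replace (Rabs c0 * (B * B ^ n) / ((INR n + 1) * f)) with (K * B / (INR n + 1)) by (unfold K; field; split; lra).
  split.
  { replace (K * B / (INR n + 1) * ((INR n + 1) / B)) with K by (field; lra). exact IH2. }
  unfold Rdiv at 1. rewrite Rabs_mult, Rabs_inv, Rabs_mult, (Rabs_pos_eq (INR n + 1)), (Rabs_pos_eq (INR n + 2 * L + 2)) by lra.
  apply Rle_trans with ((2 * Rabs eta * K + K * (INR n / B)) * / ((INR n + 1) * (INR n + 2 * L + 2))).
  { apply Rmult_le_compat_r. left; apply Rinv_0_lt_compat; nra.
    eapply Rle_trans. apply Rabs_triang. rewrite Rabs_Ropp, !Rabs_mult, (Rabs_pos_eq 2) by lra.
    apply Rplus_le_compat; [apply Rmult_le_compat_l; lra|exact IH1]. }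
  replace (K * B / (INR n + 1)) with ((K * (B * (INR n + 2 * L + 2))) * / ((INR n + 1) * (INR n + 2 * L + 2))) by (field; lra).
  apply Rmult_le_compat_r. left; apply Rinv_0_lt_compat; nra.
  replace (2 * Rabs eta * K + K * (INR n / B)) with (K * (2 * Rabs eta + INR n / B)) by ring.
  apply Rmult_le_compat_l; [exact hK|].
  assert (h1 : INR n / B <= INR n) by (apply Rle_div_l; nra).
  assert (h2 : 2 * Rabs eta <= B * (2 * L + 2)).
  { assert (1 <= A * (2 * L + 2)).
    { unfold A. rewrite Rmult_plus_distr_r. replace (1 / (2*L+2) * (2*L+2)) with 1 by (field; lra). nra. }
    unfold B. nra. }
  nra.
Qed.

Lemma coulomb_coef_entire (L eta c0 : R) : -1 < L ->
  CV_radius (coulomb_coef L eta c0) = p_infty.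
Proof.
intros hL. destruct (coulomb_coef_bound L eta c0 hL) as (M & A & hA & hM & H).
assert (E : forall x, is_lim_seq (fun n => coulomb_coef L eta c0 n * x ^ n) 0).
{ intros x. apply is_lim_seq_abs_0.
  apply is_lim_seq_le_le with (u := fun _ => 0) (w := fun n => M * (/ INR (fact n) * (A * Rabs x) ^ n)).
  - intros n. split; [apply Rabs_pos|]. rewrite Rabs_mult, <- RPow_abs, Rpow_mult_distr.
    replace (M * (/ INR (fact n) * (A ^ n * Rabs x ^ n))) with (M * A ^ n / INR (fact n) * Rabs x ^ n) by (unfold Rdiv; ring).
    apply Rmult_le_compat_r; [apply pow_le, Rabs_pos|apply H].
  - apply is_lim_seq_const.
  - replace (Finite 0) with (Rbar_mult M 0) by (simpl; f_equal; ring). apply is_lim_seq_scal_l.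
    apply ex_series_lim_0. 
    apply ex_series_ext with (fun n => scal (pow_n (A * Rabs x) n) (/ INR (fact n))).
    { intros n. rewrite pow_n_pow. apply Rmult_comm. }
    eexists; apply is_exp_Reals. }
destruct (CV_radius (coulomb_coef L eta c0)) as [r| |] eqn:Er; [|reflexivity|].
- exfalso. apply (CV_disk_outside (coulomb_coef L eta c0) (Rabs r + 1)); [|apply E].
  rewrite Er. simpl. assert (h := Rle_abs r). assert (h0 := Rabs_pos r). rewrite (Rabs_pos_eq (Rabs r + 1)); lra.
- exfalso. assert (h := CV_radius_ge_0 (coulomb_coef L eta c0)). rewrite Er in h. exact h.
Qed.

Lemma coulomb_solution_exists (L eta : R) : -1 < L -> exists F, coulomb_solution L eta F.
Proof.
intros hL. set (c := coulomb_coef L eta (coulombC L eta)).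
assert (hc : CV_radius c = p_infty) by (apply coulomb_coef_entire, hL).
assert (hc1 : CV_radius (PS_derive c) = p_infty) by (rewrite CV_radius_derive; exact hc).
set (g := PSeries c). set (g1 := PSeries (PS_derive c)). set (g2 := PSeries (PS_derive (PS_derive c))).
assert (d0 : forall x, is_derive g x (g1 x)) by (intros; apply is_derive_PSeries; rewrite hc; exact I).
assert (d1 : forall x, is_derive g1 x (g2 x)) by (intros; apply is_derive_PSeries; rewrite hc1; exact I).
assert (hg : forall x, x * g2 x + 2 * (L + 1) * g1 x + (x - 2 * eta) * g x = 0).
{ assert (s0 : forall x, is_pseries c x (g x)) by (intros; apply PSeries_correct, CV_radius_inside; rewrite hc; exact I).
  assert (s1 : forall x, is_pseries (PS_derive c) x (g1 x)) by (intros; apply PSeries_correct, CV_radius_inside; rewrite hc1; exact I).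
  assert (s2 : forall x, is_pseries (PS_derive (PS_derive c)) x (g2 x)) by (intros; apply PSeries_correct, CV_radius_inside; rewrite CV_radius_derive, hc1; exact I).
  intros x.
  assert (HS := is_pseries_plus _ _ _ _ _ (is_pseries_plus _ _ _ _ _ (is_pseries_incr_1 _ _ _ (s2 x)) (is_pseries_scal (2*(L+1)) _ _ _ (Rmult_comm _ _) (s1 x)))
     (is_pseries_plus _ _ _ _ _ (is_pseries_incr_1 _ _ _ (s0 x)) (is_pseries_scal (-2*eta) _ _ _ (Rmult_comm _ _) (s0 x)))).
  apply is_pseries_unique in HS. 
  rewrite (PSeries_ext _ (fun _ => 0)) in HS.
  - rewrite PSeries_const_0 in HS. unfold plus, scal in HS; simpl in HS. unfold mult in HS; simpl in HS. 
    lra.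
  - intros n. unfold PS_plus, PS_scal, PS_incr_1, PS_derive, plus, scal, zero; simpl. unfold mult; simpl.
    unfold c, coulomb_coef. 
    destruct n as [|n].
    + simpl. field. lra.
    + change (coulomb_coef2 L eta (coulombC L eta) (S (S n))) with 
       (let p := coulomb_coef2 L eta (coulombC L eta) (S n) in
      (snd p, (2 * eta * snd p - fst p) / (INR (S (S n)) * (INR (S n) + 2 * L + 2)))).
      cbv zeta. cbn [snd].
      change (fst (coulomb_coef2 L eta (coulombC L eta) (S n))) with (snd (coulomb_coef2 L eta (coulombC L eta) n)).
      set (u := snd (coulomb_coef2 _ _ _ (S n))). set (v := snd (coulomb_coef2 _ _ _ n)).
      change (match n with 0%nat => 1 | S _ => INR n + 1 end) with (INR (S n)).
      rewrite ?S_INR. assert (h := pos_INR n). field. split; lra. }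
set (F := fun rho => Rpower rho (L + 1) * g rho).
set (G := fun rho => Rpower rho (L + 1) * ((L + 1) / rho * g rho + g1 rho)).
assert (dR : forall rho, 0 < rho -> is_derive (fun t => Rpower t (L + 1)) rho ((L + 1) / rho * Rpower rho (L + 1))).
{ intros rho h. unfold Rpower. auto_derive. lra. field. lra. }
assert (dF : forall rho, 0 < rho -> is_derive F rho (G rho)).
{ intros rho h. unfold F. evar_last. apply (is_derive_mult (fun t => Rpower t (L + 1)) g); [apply dR, h|apply d0|intros; apply Rmult_comm].
  unfold G, plus, mult; simpl. field. lra. }
assert (dG : forall rho, 0 < rho -> is_derive G rho (- (1 - 2 * eta / rho - L * (L + 1) / rho ^ 2) * F rho)).
{ intros rho h. unfold G. 
  evar_last. apply (is_derive_mult (fun t => Rpower t (L + 1)) (fun t => (L + 1) / t * g t + g1 t)); [apply dR, h| |intros; apply Rmult_comm].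
  - apply (is_derive_plus (fun t => (L + 1) / t * g t) g1); [|apply d1].
    apply (is_derive_mult (fun t => (L + 1) / t) g); [|apply d0|intros; apply Rmult_comm].
    auto_derive. lra. reflexivity.
  - unfold F, plus, mult; simpl. assert (h2 := hg rho).
    replace (g2 rho) with (- (2 * (L + 1) * g1 rho + (rho - 2 * eta) * g rho) / rho). field. lra.
    apply Rmult_eq_reg_l with rho; [|lra]. transitivity (- (2 * (L + 1) * g1 rho + (rho - 2 * eta) * g rho)). field. lra. lra. }
assert (loc : forall rho, 0 < rho -> locally rho (fun t => G t = Derive F t)).
{ intros rho h. exists (mkposreal rho h). intros t ht. unfold ball in ht; simpl in ht. unfold AbsRing_ball, abs, minus, plus, opp in ht; simpl in ht.
  apply Rabs_def2 in ht. symmetry; apply is_derive_unique, dF. lra. }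
assert (dG' : forall rho, 0 < rho -> is_derive (Derive F) rho (- (1 - 2 * eta / rho - L * (L + 1) / rho ^ 2) * F rho)).
{ intros rho h. apply (is_derive_ext_loc G). apply loc, h. apply dG, h. }
assert (q : forall rho, F rho / Rpower rho (L + 1) = g rho).
{ intros rho. unfold F. field. unfold Rpower. apply Rgt_not_eq, exp_pos. }
exists F. split.
- intros rho h. split; [eexists; apply dF, h|split; [eexists; apply dG', h|]].
  change (Derive_n F 2 rho) with (Derive (Derive F) rho).
  rewrite (is_derive_unique _ _ _ (dG' rho h)). ring.
- exists c. intros rho h. rewrite q. apply PSeries_correct, CV_radius_inside; rewrite hc; exact I.
- apply (filterlim_ext g). intros; symmetry; apply q.
  replace (coulombC L eta) with (g 0) by (unfold g; rewrite PSeries_0; reflexivity).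
  eapply filterlim_filter_le_1. 2: apply (ex_derive_continuous g); eexists; apply d0.
  intros P [e he]. exists e. auto.
Qed.

Lemma regular_coulomb_exists (L eta : R) : -1 <= L -> exists F, regular_coulomb L eta F.
Proof.
intros hL; unfold regular_coulomb; destruct (Req_EM_T L (-1)); apply coulomb_solution_exists; lra.
Qed.

(* Main.v *)
Require Import Defs.
From Stdlib Require Import Reals Factorial Ranalysis5 Lra Lia IndefiniteDescription.
From Coquelicot Require Import Coquelicot.
Open Scope R_scope.

(** Write q = 1 - 2 eta/rho - L (L+1)/rho^2 and nu = L + 1/2, so that F'' = - q F.

    The Turan identity. The ladder relations
      sqrt (L^2 + eta^2) F_(L-1) = (L^2/rho + eta) F + L F'
      sqrt ((L+1)^2 + eta^2) F_(L+1) = ((L+1)^2/rho + eta) F - (L+1) F'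
    express the product of the neighbours through F and F', and the determinant becomes
    L (L+1) Psi F^2 ([coulomb_turan_Psi]). The first relation holds because a regular solution is
    rho^(L+1) times the power series given by a two-term recurrence from its constant term
    ([coulomb_solution_series]); the ratio of the constants C_L and C_(L-1) comes from
    |Gamma(z+1)| = |z| |Gamma(z)|, once Gauss's limit is known to exist and not to vanish
    ([Cgamma_polar], [Cmod_Cgamma_succ]). The second follows by differentiating the first.

    The zeros. They are simple, they do not stop since q tends to 1, and all of them
    exceed 2 eta since F is convex before that point ([wave_first_zero]).

    Psi on an interval between consecutive zeros. The Riccati equation of y reads
    y' = - rho Psi. The energy E = rho Psi F^2 has derivative 2 (1 - eta/rho) F^2 and is positive
    at zeros; it grows beyond eta, so Psi > 0 between zeros and y decreases from +oo to -oo. Next,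
    Psi' = - (2/rho) ((1+y) Psi - 1 + eta/rho), and the last factor times rho F^2 is strictly
    decreasing ([arch_slope_decreasing]); so Psi has one critical point, a strict minimum
    ([arch_minimum]). At the point where y = 0 one sees Psi < 1 and Psi' > 0: the minimum is less
    than 1 and is attained where y > 0.

    Monotonicity of the minima. Compare two successive intervals at points with equal y. For
    fixed y, Psi is the quadratic 1 - 2 eta v + (y^2 - nu^2) v^2 in v = 1/rho, and the critical
    point equation bounds y^2 - nu^2 well enough to show that, when y is the value at the later
    minimum, this quadratic is smaller at the earlier point ([Psi_comparison]). Finally
    Psi >= 1 - 2 eta/rho - nu^2/rho^2 squeezes the minima to 1. *)

(** * Calculus *)

Lemma is_derive_MVT (f df : R -> R) (a b : R) :
  a < b -> (forall t, a <= t <= b -> is_derive f t (df t)) ->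
  exists c, a < c < b /\ f b - f a = df c * (b - a).
Proof.
intros hab hd.
destruct (MVT_cor2 f df a b hab) as (c & e & hc).
{ intros c hc. apply is_derive_Reals, hd, hc. }
exists c; auto.
Qed.

Lemma is_derive_continuity_pt (f : R -> R) (t l : R) :
  is_derive f t l -> continuity_pt f t.
Proof.
intros h. apply continuity_pt_filterlim, (ex_derive_continuous f). exists l; exact h.
Qed.

Lemma simple_zero_sign (f : R -> R) (x l : R) :
  is_derive f x l -> f x = 0 -> l <> 0 ->
  exists d, 0 < d /\ forall t, t <> x -> x - d < t < x + d -> 0 < l * f t * (t - x).
Proof.
intros h f0 hl. apply is_derive_Reals in h.
assert (hl' : 0 < Rabs l) by (apply Rabs_pos_lt, hl).
destruct (h (Rabs l / 2)) as (d & hd); [lra|].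
exists d. split; [apply cond_pos|]. intros t ht hb.
specialize (hd (t - x)). replace (x + (t - x)) with t in hd by ring.
rewrite f0 in hd.
assert (hd' : Rabs ((f t - 0) / (t - x) - l) < Rabs l / 2).
{ apply hd; [lra|]. apply Rabs_def1; lra. }
set (k := (f t - 0) / (t - x)) in *.
assert (hk : f t = k * (t - x)) by (unfold k; field; lra).
rewrite hk.
assert (hlk : 0 < l * k).
{ unfold Rabs in hd', hl'. destruct (Rcase_abs l), (Rcase_abs (k - l)); nra. }
replace (l * (k * (t - x)) * (t - x)) with (l * k * Rsqr (t - x)) by (unfold Rsqr; ring).
apply Rmult_lt_0_compat; [exact hlk|]. apply Rsqr_pos_lt. lra.
Qed.

Lemma locally_pos (P : R -> Prop) (rho : R) :
  0 < rho -> (forall t, 0 < t -> P t) -> locally rho P.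
Proof.
intros hr hP. exists (mkposreal rho hr). intros t ht. apply hP.
unfold ball in ht; simpl in ht. unfold AbsRing_ball, abs, minus, plus, opp in ht; simpl in ht.
apply Rabs_def2 in ht. lra.
Qed.

Lemma is_lim_seq_inv_S : is_lim_seq (fun n => / INR (S n)) 0.
Proof.
apply (is_lim_seq_incr_1 (fun n => / INR n)).
replace (Finite 0) with (Rbar_inv p_infty) by reflexivity.
apply is_lim_seq_inv; [apply is_lim_seq_INR|discriminate].
Qed.

(** An increment of size K / n^2 is absorbed by the telescoping sum of 1 / (n (n - 1)). *)
Lemma ex_lim_of_small_increments (u : nat -> R) (K : R) :
  0 <= K ->
  (forall n, (1 <= n)%nat -> Rabs (u (S n) - u n) <= K / INR (S n) ^ 2) ->
  ex_finite_lim_seq u.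
Proof.
intros hK hu.
assert (hinv : forall n, 0 < / INR (S n)).
{ intros n. apply Rinv_0_lt_compat, lt_0_INR. lia. }
assert (hstep : forall n, K / INR (S (S n)) ^ 2 <= K * / INR (S n) - K * / INR (S (S n))).
{ intros n. rewrite <- Rmult_minus_distr_l. apply Rmult_le_compat_l; [exact hK|].
  rewrite (S_INR (S n)). set (m := INR (S n)). assert (hm : 0 < m) by (apply lt_0_INR; lia).
  replace (/ m - / (m + 1)) with (/ (m * (m + 1))) by (field; lra).
  apply Rinv_le_contravar; nra. }
assert (hb : forall n, u (S n) - K * / INR (S n) <= u (S (S n)) - K * / INR (S (S n)) /\
   u (S (S n)) + K * / INR (S (S n)) <= u (S n) + K * / INR (S n)).
{ intros n. assert (a := hu (S n) ltac:(lia)). assert (b := hstep n). apply Rabs_le_between in a. lra. }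
assert (ub : forall n, u (S n) + K * / INR (S n) <= u 1%nat + K * / INR 1).
{ induction n as [|n IH]; [lra|]. destruct (hb n). lra. }
(* u + K / n decreases and bounds the increasing u - K / n from above *)
destruct (ex_finite_lim_seq_incr (fun n => u (S n) - K * / INR (S n)) (u 1%nat + K * / INR 1)) as (l & hl).
- intros n. apply hb.
- intros n. assert (a := ub n). assert (b := Rmult_le_pos _ _ hK (Rlt_le _ _ (hinv n))). lra.
- exists l. apply is_lim_seq_incr_1.
  apply is_lim_seq_ext with (fun n => (u (S n) - K * / INR (S n)) + K * / INR (S n)); [intros; ring|].
  replace (Finite l) with (Finite (l + K * 0)) by (f_equal; ring).
  apply is_lim_seq_plus'; [exact hl|].
  apply (is_lim_seq_scal_l (fun n => / INR (S n)) K 0).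
  apply is_lim_seq_inv_S.
Qed.

Lemma ln_1p_bounds (s : R) : -1 < s -> s / (1 + s) <= ln (1 + s) <= s.
Proof.
assert (H : forall t, -1 < t -> ln (1 + t) <= t).
{ intros t ht. rewrite <- (ln_exp t) at 2. apply ln_le; [lra|]. apply exp_ineq1_le. }
intros hs. split; [|apply H, hs].
assert (h : 0 < / (1 + s)) by (apply Rinv_0_lt_compat; lra).
assert (e : - (s / (1 + s)) = / (1 + s) - 1) by (field; lra).
assert (h2 := H (- (s / (1 + s))) ltac:(lra)).
replace (1 + - (s / (1 + s))) with (/ (1 + s)) in h2 by (field; lra).
rewrite ln_Rinv in h2 by lra. lra.
Qed.

Lemma atan_bounds (u : R) : 0 <= u -> u - u ^ 2 <= atan u <= u.
Proof.
intros [hu|<-]; [|rewrite atan_0; lra].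
destruct (MVT_cor2 atan (fun t => / (1 + t ^ 2)) 0 u hu) as (c & e & hc).
{ intros c _. apply derivable_pt_lim_atan. }
rewrite atan_0 in e.
assert (h : / (1 + c ^ 2) <= 1) by (rewrite <- Rinv_1; apply Rinv_le_contravar; nra).
assert (h' : 1 - c <= / (1 + c ^ 2)).
{ replace (/ (1 + c ^ 2)) with (1 / (1 + c ^ 2)) by (unfold Rdiv; ring).
  apply Rle_div_r; nra. }
nra.
Qed.

(** * Gauss's limit for Gamma and the normalizing constant *)

(** exp (a + i b); in this form the products in Gauss's formula become sums. *)
Definition Cpolar (a b : R) : C := (exp a * cos b, exp a * sin b).

Lemma Cpolar_mult (a b a' b' : R) :
  (Cpolar a b * Cpolar a' b')%C = Cpolar (a + a') (b + b').
Proof.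
unfold Cpolar, Cmult; simpl. rewrite exp_plus, cos_plus, sin_plus. f_equal; ring.
Qed.

Lemma Cpolar_neq_0 (a b : R) : Cpolar a b <> 0%C.
Proof.
intros e. injection e as e1 e2. assert (h := exp_pos a). assert (h2 := sin2_cos2 b).
apply Rmult_integral in e1. apply Rmult_integral in e2. unfold Rsqr in h2. nra.
Qed.

Lemma Cpolar_div (a b a' b' : R) :
  (Cpolar a b / Cpolar a' b')%C = Cpolar (a - a') (b - b').
Proof.
assert (h := Cpolar_neq_0 a' b').
replace (Cpolar a b) with (Cpolar (a - a') (b - b') * Cpolar a' b')%C.
- field. exact h.
- rewrite Cpolar_mult. f_equal; ring.
Qed.

Lemma Cmod_Cpolar (a b : R) : Cmod (Cpolar a b) = exp a.
Proof.
unfold Cmod, Cpolar; simpl fst; simpl snd.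
replace ((exp a * cos b) ^ 2 + (exp a * sin b) ^ 2) with (exp a ^ 2 * (Rsqr (sin b) + Rsqr (cos b))) by (unfold Rsqr; ring).
rewrite sin2_cos2, Rmult_1_r. apply sqrt_pow2. left; apply exp_pos.
Qed.

(** The arctangent gives the argument only in the right half-plane, which is why Gauss's limit
    is studied for Re z > 0. *)
Lemma Cpolar_right_half (s y : R) : 0 < s ->
  ((s, y) : C) = Cpolar (ln (s ^ 2 + y ^ 2) / 2) (atan (y / s)).
Proof.
intros hs. unfold Cpolar. assert (hr : 0 < s ^ 2 + y ^ 2) by nra.
replace (exp (ln (s ^ 2 + y ^ 2) / 2)) with (sqrt (s ^ 2 + y ^ 2)).
2:{ rewrite <- Rpower_sqrt by exact hr. unfold Rpower. f_equal. field. }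
rewrite cos_atan, sin_atan.
replace (s ^ 2 + y ^ 2) with (s ^ 2 * (1 + (y / s)²)) by (unfold Rsqr; field; lra).
assert (h1 : 0 < 1 + (y / s)²) by (assert (h := Rle_0_sqr (y / s)); lra).
rewrite sqrt_mult, sqrt_pow2 by (try lra; nra).
assert (h2 := sqrt_lt_R0 _ h1). f_equal; field; lra.
Qed.

(** Log-modulus of n! n^z / (z (z+1) ... (z+n)) at z = x + i y. *)
Definition gauss_log (x y : R) (n : nat) : R :=
  ln (INR (fact n)) + x * ln (INR n)
  - sum_f_R0 (fun k => ln ((x + INR k) ^ 2 + y ^ 2) / 2) n.

(** A continuous branch of the argument of the same quotient; convergence of this real
    sequence, not only modulo 2 PI, is what the convergence of its cosine and sine rests on. *)
Definition gauss_arg (x y : R) (n : nat) : R :=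
  y * ln (INR n) - sum_f_R0 (fun k => atan (y / (x + INR k))) n.

Lemma gauss_seq_polar (x y : R) (n : nat) : 0 < x ->
  gauss_seq (x, y) n = Cpolar (gauss_log x y n) (gauss_arg x y n).
Proof.
intros hx.
assert (H : forall m, Crising (x, y) m =
   Cpolar (sum_f_R0 (fun k => ln ((x + INR k) ^ 2 + y ^ 2) / 2) m)
          (sum_f_R0 (fun k => atan (y / (x + INR k))) m)).
{ induction m as [|m IH].
  - cbn [sum_f_R0 Crising INR]. rewrite Rplus_0_r, <- Cpolar_right_half by exact hx. reflexivity.
  - cbn [sum_f_R0 Crising]. rewrite IH, <- Cpolar_mult.
    rewrite <- (Cpolar_right_half (x + INR (S m)) y) by (assert (h := pos_INR (S m)); lra).
    f_equal. unfold Cplus, RtoC; cbn [fst snd]. f_equal. ring. }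
unfold gauss_seq. rewrite H.
replace (RtoC (INR (fact n))) with (Cpolar (ln (INR (fact n))) 0).
2:{ unfold Cpolar, RtoC. rewrite exp_ln by apply INR_fact_lt_0. rewrite cos_0, sin_0. f_equal; ring. }
change (Cpower (INR n) (x, y)) with (Cpolar (x * ln (INR n)) (y * ln (INR n))).
rewrite Cpolar_mult, Cpolar_div. unfold gauss_log, gauss_arg. f_equal. ring.
Qed.

(** With t = 1 / (n + 1) the middle term is - ln (1 - t) = t + O(t^2). *)
Lemma ln_ratio_bounds (n : nat) : (1 <= n)%nat ->
  / INR (S n) <= ln (INR (S n)) - ln (INR n) <= / INR (S n) + 2 * (/ INR (S n)) ^ 2.
Proof.
intros hn. rewrite S_INR. assert (h := le_INR 1 n hn). simpl in h. set (m := INR n) in *.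
set (t := / (m + 1)).
assert (ht : 0 < t) by (apply Rinv_0_lt_compat; lra).
assert (ht2 : t <= 1 / 2) by (unfold t; apply Rle_trans with (/ 2); [apply Rinv_le_contravar|]; lra).
assert (e : ln m = ln (m + 1) + ln (1 + - t)).
{ rewrite <- ln_mult by lra. f_equal. unfold t. field. lra. }
destruct (ln_1p_bounds (- t)) as (h1 & h2); [lra|].
assert (- t - 2 * t ^ 2 <= - t / (1 + - t)) by (apply Rle_div_r; nra). lra.
Qed.

(** The step from n - 1 to n multiplies Gauss's quotient by
    (1 - 1/n)^(-z) / (1 + z/n) = 1 + O(1/n^2). *)
Lemma gauss_log_converges (x y : R) : 0 < x -> ex_finite_lim_seq (gauss_log x y).
Proof.
intros hx. set (c := x ^ 2 + y ^ 2). assert (hc : 0 < c) by (unfold c; nra).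
apply ex_lim_of_small_increments with (c / 2 + 2 * x + (2 * x + c) ^ 2 / 2); [nra|].
intros n hn. destruct (ln_ratio_bounds n hn) as (h1 & h2).
unfold gauss_log. rewrite tech5, fact_simpl, mult_INR.
assert (hm : 0 < INR (S n)) by (apply lt_0_INR; lia).
rewrite ln_mult by (try apply INR_fact_lt_0; assumption).
assert (hm2 : 2 <= INR (S n)) by (rewrite S_INR; assert (h := le_INR 1 n hn); simpl in h; lra).
set (m := INR (S n)) in *. set (t := / m) in *.
assert (ht : 0 < t) by (apply Rinv_0_lt_compat; lra).
assert (ht2 : t <= 1 / 2) by (unfold t; apply Rle_trans with (/ 2); [apply Rinv_le_contravar|]; lra).
set (s := 2 * x * t + c * t ^ 2).
assert (hs : 0 < s) by (unfold s; nra).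
(* the increment is - x ln (1 - t) - ln (1 + s) / 2: the terms x t cancel *)
replace ((x + m) ^ 2 + y ^ 2) with (m * m * (1 + s)) by (unfold s, c, t; field; lra).
rewrite !ln_mult by nra.
destruct (ln_1p_bounds s) as (h3 & h4); [lra|].
assert (h5 : s - s ^ 2 <= s / (1 + s)) by (apply Rle_div_r; nra).
assert (h6 : s <= (2 * x + c) * t).
{ assert (c * t ^ 2 <= c * t) by (apply Rmult_le_compat_l; nra). unfold s. lra. }
assert (h7 : s ^ 2 <= (2 * x + c) ^ 2 * t ^ 2) by (rewrite <- Rpow_mult_distr; apply pow_incr; lra).
assert (h8 : 0 <= x * (ln m - ln (INR n)) - x * t <= 2 * x * t ^ 2) by nra.
replace (_ / m ^ 2) with ((c / 2 + 2 * x + (2 * x + c) ^ 2 / 2) * t ^ 2)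
  by (unfold t; field; lra).
set (lm := ln m) in *. set (ln0 := ln (INR n)) in *. set (ls := ln (1 + s)) in *.
set (sm := sum_f_R0 _ _). set (lf := ln (INR (fact n))).
replace (lm + lf + x * lm - (sm + (lm + lm + ls) / 2) - (lf + x * ln0 - sm))
  with (x * (lm - ln0) - ls / 2) by field.
assert (0 <= x * t ^ 2) by nra. assert (0 <= c * t ^ 2) by nra.
assert (0 <= (2 * x + c) ^ 2 * t ^ 2) by (apply Rmult_le_pos; apply pow2_ge_0).
apply Rabs_le. unfold s in *. lra.
Qed.

Lemma gauss_arg_converges (x y : R) : 0 < x -> 0 <= y -> ex_finite_lim_seq (gauss_arg x y).
Proof.
intros hx hy.
apply ex_lim_of_small_increments with (2 * y + x * y + y ^ 2); [nra|].
intros n hn. destruct (ln_ratio_bounds n hn) as (h1 & h2).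
unfold gauss_arg. rewrite tech5.
assert (hm2 : 2 <= INR (S n)) by (rewrite S_INR; assert (h := le_INR 1 n hn); simpl in h; lra).
set (m := INR (S n)) in *. set (t := / m) in *.
assert (ht : 0 < t) by (apply Rinv_0_lt_compat; lra).
set (u := y / (x + m)).
assert (hu : 0 <= u) by (apply Rdiv_le_0_compat; lra).
assert (hu1 : u = y * t - x * t * u) by (unfold u, t; field; lra).
assert (hxt : 0 <= x * t) by nra.
assert (hu2 : u <= y * t) by nra.
assert (hu3 : y * t - x * y * t ^ 2 <= u) by nra.
destruct (atan_bounds u hu) as (h3 & h4).
assert (h7 : u ^ 2 <= y ^ 2 * t ^ 2) by (rewrite <- Rpow_mult_distr; apply pow_incr; lra).
assert (h8 : 0 <= y * (ln m - ln (INR n)) - y * t <= 2 * y * t ^ 2) by nra.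
(* the increment is - y ln (1 - t) - atan u with u = y t + O(t ^ 2) *)
replace (_ / m ^ 2) with ((2 * y + x * y + y ^ 2) * t ^ 2) by (unfold t; field; lra).
assert (0 <= y * t ^ 2) by nra.
assert (0 <= y ^ 2 * t ^ 2) by (apply Rmult_le_pos; apply pow2_ge_0).
assert (0 <= x * y * t ^ 2) by (apply Rmult_le_pos; nra).
apply Rabs_le. lra.
Qed.

Lemma Cgamma_polar (x y : R) : 0 < x -> 0 <= y ->
  Cgamma (x, y) = Cpolar (real (Lim_seq (gauss_log x y))) (real (Lim_seq (gauss_arg x y))).
Proof.
intros hx hy.
destruct (gauss_log_converges x y hx) as (a & ha).
destruct (gauss_arg_converges x y hx hy) as (b & hb).
rewrite (is_lim_seq_unique _ _ ha), (is_lim_seq_unique _ _ hb).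
assert (hexp : is_lim_seq (fun n => exp (gauss_log x y n)) (exp a)).
{ apply is_lim_seq_continuous; [apply derivable_continuous_pt, derivable_pt_exp|exact ha]. }
unfold Cgamma, Cpolar. f_equal.
- rewrite (Lim_seq_ext _ (fun n => exp (gauss_log x y n) * cos (gauss_arg x y n))).
  + rewrite (is_lim_seq_unique _ (exp a * cos b)); [reflexivity|].
    apply is_lim_seq_mult'; [exact hexp|]. apply is_lim_seq_continuous; [apply continuity_cos|exact hb].
  + intros n. rewrite gauss_seq_polar by exact hx. reflexivity.
- rewrite (Lim_seq_ext _ (fun n => exp (gauss_log x y n) * sin (gauss_arg x y n))).
  + rewrite (is_lim_seq_unique _ (exp a * sin b)); [reflexivity|].
    apply is_lim_seq_mult'; [exact hexp|]. apply is_lim_seq_continuous; [apply continuity_sin|exact hb].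
  + intros n. rewrite gauss_seq_polar by exact hx. reflexivity.
Qed.

Lemma Cmod_Cgamma_pos (x y : R) : 0 < x -> 0 <= y -> 0 < Cmod (Cgamma (x, y)).
Proof.
intros hx hy. rewrite Cgamma_polar, Cmod_Cpolar by assumption. apply exp_pos.
Qed.

(** Gauss's quotients at z + 1 and at z differ by the factor n z / (z + n + 1),
    which tends to z. *)
Lemma Cmod_Cgamma_succ (x y : R) : 0 < x -> 0 <= y ->
  Cmod (Cgamma (x + 1, y)) = sqrt (x ^ 2 + y ^ 2) * Cmod (Cgamma (x, y)).
Proof.
intros hx hy. rewrite !Cgamma_polar, !Cmod_Cpolar by lra.
assert (hr : 0 < x ^ 2 + y ^ 2) by nra.
destruct (gauss_log_converges x y hx) as (a & ha).
rewrite (is_lim_seq_unique _ _ ha).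
enough (h : is_lim_seq (gauss_log (x + 1) y) (a + ln (x ^ 2 + y ^ 2) / 2)).
{ rewrite (is_lim_seq_unique _ _ h). cbn [real]. rewrite exp_plus, Rmult_comm. f_equal.
  rewrite <- Rpower_sqrt by exact hr. unfold Rpower. f_equal. field. }
assert (hsum : forall n, sum_f_R0 (fun k => ln ((x + 1 + INR k) ^ 2 + y ^ 2) / 2) n
   = sum_f_R0 (fun k => ln ((x + INR k) ^ 2 + y ^ 2) / 2) n
     + ln ((x + INR (S n)) ^ 2 + y ^ 2) / 2 - ln (x ^ 2 + y ^ 2) / 2).
{ intros n. induction n as [|n IH].
  - simpl. rewrite !Rplus_0_r. ring.
  - rewrite !(tech5 _ n), IH. rewrite (S_INR (S n)).
    replace (x + 1 + INR (S n)) with (x + (INR (S n) + 1)) by ring. ring. }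
assert (hz : is_lim_seq (fun n => / INR (S n)) 0).
{ apply is_lim_seq_inv_S. }
(* the factor n z / (z + n + 1) in polar form *)
apply is_lim_seq_ext with (fun n => gauss_log x y n + (ln (x ^ 2 + y ^ 2) / 2
   + (ln (INR n) - ln ((x + INR (S n)) ^ 2 + y ^ 2) / 2))).
{ intros n. unfold gauss_log. rewrite hsum. ring. }
apply is_lim_seq_plus'; [exact ha|].
replace (Finite (ln (x ^ 2 + y ^ 2) / 2)) with (Finite (ln (x ^ 2 + y ^ 2) / 2 + 0)) by (f_equal; ring).
apply is_lim_seq_plus'; [apply is_lim_seq_const|].
apply is_lim_seq_incr_1.
set (h := fun t => (ln (1 - t) - ln ((1 + x * t) ^ 2 + (y * t) ^ 2) / 2)).
assert (hlim : is_lim_seq (fun n => h (/ INR (S (S n)))) (h 0)).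
{ apply is_lim_seq_continuous; [|apply (is_lim_seq_incr_1 (fun n => / INR (S n))); exact hz].
  apply continuity_pt_filterlim, (ex_derive_continuous h). unfold h. auto_derive. repeat split; nra. }
replace 0 with (h 0) at 1; [|unfold h; rewrite !Rmult_0_r, Rminus_0_r, Rplus_0_r, pow1, pow_i, Rplus_0_r, ln_1 by lia; lra].
eapply is_lim_seq_ext; [|exact hlim].
intros n. cbv beta. unfold h.
assert (hn : 0 < INR (S n)) by (apply lt_0_INR; lia).
rewrite (S_INR (S n)). set (m := INR (S n)) in *.
replace (1 - / (m + 1)) with (m * / (m + 1)) by (field; lra).
replace ((1 + x * / (m + 1)) ^ 2 + (y * / (m + 1)) ^ 2)
  with (((x + (m + 1)) ^ 2 + y ^ 2) * (/ (m + 1) * / (m + 1))) by (field; lra).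
assert (hi : 0 < / (m + 1)) by (apply Rinv_0_lt_compat; lra).
rewrite !ln_mult by (try nra; assumption). rewrite !ln_Rinv by nra. field.
Qed.

Lemma Cgamma_real (x : R) : 0 < x -> Re (Cgamma (x, 0)) = Cmod (Cgamma (x, 0)).
Proof.
intros hx. rewrite Cgamma_polar, Cmod_Cpolar by lra.
rewrite (Lim_seq_ext (gauss_arg x 0) (fun _ => 0)), Lim_seq_const.
- simpl. rewrite cos_0. ring.
- intros n. unfold gauss_arg. rewrite (sum_eq _ (fun _ => 0)).
  + rewrite sum_cte. ring.
  + intros k _. unfold Rdiv. rewrite Rmult_0_l. apply atan_0.
Qed.

Lemma coulombC_pos (L eta : R) : 0 <= L -> 0 <= eta -> 0 < coulombC L eta.
Proof.
intros hL heta. unfold coulombC, RtoC. rewrite Cgamma_real by lra.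
apply Rdiv_lt_0_compat; [|apply Cmod_Cgamma_pos; lra].
apply Rmult_lt_0_compat; [|apply Cmod_Cgamma_pos; lra].
apply Rmult_lt_0_compat; apply exp_pos.
Qed.

(** This is C_L / C_(L-1) = 2 sqrt (L^2 + eta^2) / (2 L (2 L + 1)): one step of Gamma at
    L + i eta against two steps of Gamma at 2 L. It is exactly the ratio that makes the
    leading coefficients agree in the lowering relation. *)
Lemma coulombC_step (L eta : R) : 0 < L -> 0 <= eta ->
  sqrt (L ^ 2 + eta ^ 2) * coulombC (L - 1) eta = L * (2 * L + 1) * coulombC L eta.
Proof.
intros hL heta. unfold coulombC, RtoC. rewrite !Cgamma_real by lra.
rewrite (Cmod_Cgamma_succ L eta) by lra.
replace (2 * L + 2) with (2 * L + 1 + 1) by ring. rewrite (Cmod_Cgamma_succ (2 * L + 1) 0) by lra.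
rewrite (Cmod_Cgamma_succ (2 * L) 0) by lra.
replace (2 * (L - 1) + 2) with (2 * L) by ring. replace (L - 1 + 1) with L by ring.
replace ((2 * L) ^ 2 + 0 ^ 2) with ((2 * L) ^ 2) by ring.
replace ((2 * L + 1) ^ 2 + 0 ^ 2) with ((2 * L + 1) ^ 2) by ring.
rewrite !sqrt_pow2 by lra.
replace (Rpower 2 L) with (Rpower 2 (L - 1) * 2).
2:{ rewrite <- (Rpower_1 2) at 2 by lra. rewrite <- Rpower_plus. f_equal. ring. }
assert (h := Cmod_Cgamma_pos (2 * L) 0 ltac:(lra) ltac:(lra)).
field. lra.
Qed.

(** * Power series and uniqueness of the regular solution *)

Lemma ex_pseries_CV_infinite (c : nat -> R) :
  (forall x, 0 < x -> ex_pseries c x) -> CV_radius c = p_infty.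
Proof.
intros h.
assert (E : forall x, 0 < x -> is_lim_seq (fun n => c n * x ^ n) 0).
{ intros x hx. apply ex_series_lim_0. apply (ex_series_ext (fun n => scal (pow_n x n) (c n))).
  - intros n. rewrite pow_n_pow. apply Rmult_comm.
  - apply h, hx. }
destruct (CV_radius c) as [r| |] eqn:Er; [|reflexivity|].
- exfalso. assert (h1 := Rle_abs r). assert (h0 := Rabs_pos r).
  apply (CV_disk_outside c (Rabs r + 1)); [|apply E; lra].
  rewrite Er. simpl. rewrite (Rabs_pos_eq (Rabs r + 1)); lra.
- exfalso. assert (h0 := CV_radius_ge_0 c). rewrite Er in h0. exact h0.
Qed.

(** Only one side of the origin is available, since the quotient rho^(-L-1) F is known for
    positive rho; the constant term vanishes by continuity and can then be divided out. *)
Lemma PSeries_eq_0_right (e : nat -> R) :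
  CV_radius e = p_infty -> (forall x, 0 < x -> PSeries e x = 0) -> forall n, e n = 0.
Proof.
intros hc h n. revert e hc h.
assert (H : forall e, CV_radius e = p_infty -> (forall x, 0 < x -> PSeries e x = 0) -> e O = 0).
{ intros e hc h.
  assert (hcont : continuity_pt (PSeries e) 0) by (apply PSeries_continuity; rewrite hc; exact I).
  assert (hlim : is_lim_seq (fun n => PSeries e (/ INR (S n))) (PSeries e 0)).
  { apply is_lim_seq_continuous; [exact hcont|].
    apply is_lim_seq_inv_S. }
  rewrite PSeries_0 in hlim. apply is_lim_seq_unique in hlim.
  rewrite (Lim_seq_ext _ (fun _ => 0)), Lim_seq_const in hlim; [injection hlim; auto|].
  intros k. apply h, Rinv_0_lt_compat, lt_0_INR. lia. }
induction n as [|n IH]; intros e hc h; [apply H; assumption|].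
apply (IH (PS_decr_1 e)).
- rewrite CV_radius_decr_1. exact hc.
- intros x hx. assert (a := PSeries_decr_1 e x).
  rewrite (H e hc h), (h x hx) in a.
  assert (b := a ltac:(apply CV_radius_inside; rewrite hc; exact I)). nra.
Qed.

Lemma coulomb_coef_unique (L eta c0 : R) (c : nat -> R) : -1 < L ->
  c O = c0 -> (2 * L + 2) * c 1%nat = 2 * eta * c O ->
  (forall n, (INR n + 2) * (INR n + 2 * L + 3) * c (S (S n)) = 2 * eta * c (S n) - c n) ->
  forall n, c n = coulomb_coef L eta c0 n.
Proof.
intros hL h0 h1 hr n.
enough (H : c n = coulomb_coef L eta c0 n /\ c (S n) = coulomb_coef L eta c0 (S n)) by apply H.
induction n as [|n [IH1 IH2]].
- split; [exact h0|]. unfold coulomb_coef. simpl. rewrite <- h0.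
  apply Rmult_eq_reg_l with (2 * L + 2); [|lra]. rewrite h1. field. lra.
- split; [exact IH2|].
  change (coulomb_coef L eta c0 (S (S n))) with
    ((2 * eta * coulomb_coef L eta c0 (S n) - coulomb_coef L eta c0 n)
      / (INR (S (S n)) * (INR (S n) + 2 * L + 2))).
  rewrite <- IH1, <- IH2, <- hr, !S_INR. assert (h := pos_INR n). field. lra.
Qed.

Lemma coulomb_coef_rec (L eta c0 : R) : -1 < L ->
  let c := coulomb_coef L eta c0 in
  (2 * L + 2) * c 1%nat = 2 * eta * c O /\
  forall n, (INR n + 2) * (INR n + 2 * L + 3) * c (S (S n)) = 2 * eta * c (S n) - c n.
Proof.
intros hL c. split.
- unfold c, coulomb_coef. simpl. field. lra.
- intros n. unfold c.
  change (coulomb_coef L eta c0 (S (S n))) with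
    ((2 * eta * coulomb_coef L eta c0 (S n) - coulomb_coef L eta c0 n)
      / (INR (S (S n)) * (INR (S n) + 2 * L + 2))).
  rewrite !S_INR. assert (h := pos_INR n). field. lra.
Qed.

Lemma is_derive_Rpower_mult (s : R) (g : R -> R) (rho l : R) : 0 < rho ->
  is_derive g rho l ->
  is_derive (fun t => Rpower t s * g t) rho (Rpower rho s * (s / rho * g rho + l)).
Proof.
intros hr hg. unfold Rpower. auto_derive; [split; [exact hr|split; [eexists; exact hg|exact I]]|].
change (Derive (fun x => g x) rho) with (Derive g rho). rewrite (is_derive_unique _ _ _ hg). field. lra.
Qed.

Lemma Rpower_pos (t s : R) : 0 < Rpower t s.
Proof. apply exp_pos. Qed.

(** The equation for F = rho^(L+1) g becomes rho g'' + 2 (L+1) g' + (rho - 2 eta) g = 0. Its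
    recurrence (n+1) (n+2L+2) c_(n+1) = 2 eta c_n - c_(n-1) has no vanishing factor when
    L > -1, so c_0 determines g and the regular solution is unique. *)
Lemma coulomb_solution_series (L eta : R) (F : R -> R) : -1 < L ->
  coulomb_solution L eta F ->
  forall rho, 0 < rho ->
    F rho = Rpower rho (L + 1) * PSeries (coulomb_coef L eta (coulombC L eta)) rho.
Proof.
intros hL [hode (c & hc) hnorm].
assert (cv : CV_radius c = p_infty).
{ apply ex_pseries_CV_infinite. intros x hx. eexists. apply hc, hx. }
assert (cv1 : CV_radius (PS_derive c) = p_infty) by (rewrite CV_radius_derive; exact cv).
assert (cv2 : CV_radius (PS_derive (PS_derive c)) = p_infty) by (rewrite CV_radius_derive; exact cv1).
set (g := PSeries c). set (g1 := PSeries (PS_derive c)). set (g2 := PSeries (PS_derive (PS_derive c))).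
assert (d0 : forall x, is_derive g x (g1 x)) by (intros; apply is_derive_PSeries; rewrite cv; exact I).
assert (d1 : forall x, is_derive g1 x (g2 x)) by (intros; apply is_derive_PSeries; rewrite cv1; exact I).
assert (q : forall rho, 0 < rho -> F rho / Rpower rho (L + 1) = g rho).
{ intros rho hr. symmetry. apply is_pseries_unique, hc, hr. }
assert (hF : forall rho, 0 < rho -> F rho = Rpower rho (L + 1) * g rho).
{ intros rho hr. rewrite <- q by exact hr. field. apply Rgt_not_eq, Rpower_pos. }
assert (hF1 : forall rho, 0 < rho -> Derive F rho = Rpower rho (L + 1) * ((L + 1) / rho * g rho + g1 rho)).
{ intros rho hr. apply is_derive_unique.
  apply is_derive_ext_loc with (fun t => Rpower t (L + 1) * g t).
  - apply locally_pos; [exact hr|]. intros; symmetry; auto.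
  - apply is_derive_Rpower_mult; auto. }
assert (hg : forall rho, 0 < rho -> rho * g2 rho + 2 * (L + 1) * g1 rho + (rho - 2 * eta) * g rho = 0).
{ intros rho hr. destruct (hode rho hr) as (_ & _ & e).
  change (Derive_n F 2 rho) with (Derive (Derive F) rho) in e.
  assert (e2 : Derive (Derive F) rho = Rpower rho (L + 1) *
     ((L + 1) / rho * ((L + 1) / rho * g rho + g1 rho)
       + (- (L + 1) / rho ^ 2 * g rho + (L + 1) / rho * g1 rho + g2 rho))).
  { apply is_derive_unique.
    apply is_derive_ext_loc with (fun t => Rpower t (L + 1) * ((L + 1) / t * g t + g1 t)).
    - apply locally_pos; [exact hr|]. intros; symmetry; auto.
    - apply (is_derive_Rpower_mult (L + 1) (fun t => (L + 1) / t * g t + g1 t)); [exact hr|].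
      assert (a1 := d0 rho). assert (a2 := d1 rho).
      auto_derive; [split; [lra|split; [eexists; exact a1|split; [eexists; exact a2|exact I]]]|].
      change (Derive (fun x => g x) rho) with (Derive g rho).
      change (Derive (fun x => g1 x) rho) with (Derive g1 rho).
      rewrite (is_derive_unique _ _ _ a1), (is_derive_unique _ _ _ a2). field. lra. }
  rewrite e2, hF in e by exact hr.
  apply Rmult_eq_reg_l with (Rpower rho (L + 1) / rho).
  2:{ apply Rgt_not_eq, Rdiv_lt_0_compat; [apply Rpower_pos|exact hr]. }
  rewrite Rmult_0_r, <- e. field. lra. }
set (d := PS_plus (PS_plus (PS_incr_1 (PS_derive (PS_derive c))) (PS_scal (2 * (L + 1)) (PS_derive c)))
           (PS_plus (PS_incr_1 c) (PS_scal (- 2 * eta) c))).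
assert (hd : forall x, is_pseries d x (x * g2 x + 2 * (L + 1) * g1 x + (x - 2 * eta) * g x)).
{ intros x.
  assert (s0 : is_pseries c x (g x)) by (apply PSeries_correct, CV_radius_inside; rewrite cv; exact I).
  assert (s1 : is_pseries (PS_derive c) x (g1 x)) by (apply PSeries_correct, CV_radius_inside; rewrite cv1; exact I).
  assert (s2 : is_pseries (PS_derive (PS_derive c)) x (g2 x)) by (apply PSeries_correct, CV_radius_inside; rewrite cv2; exact I).
  assert (HS := is_pseries_plus _ _ _ _ _ (is_pseries_plus _ _ _ _ _ (is_pseries_incr_1 _ _ _ s2)
       (is_pseries_scal (2*(L+1)) _ _ _ (Rmult_comm _ _) s1))
     (is_pseries_plus _ _ _ _ _ (is_pseries_incr_1 _ _ _ s0) (is_pseries_scal (-2*eta) _ _ _ (Rmult_comm _ _) s0))).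
  fold d in HS.
  match type of HS with is_pseries _ _ ?v => replace (x * g2 x + 2 * (L + 1) * g1 x + (x - 2 * eta) * g x) with v; [exact HS|] end.
  unfold plus, scal; simpl. unfold mult; simpl. ring. }
assert (hd0 : forall n, d n = 0).
{ apply PSeries_eq_0_right.
  - apply ex_pseries_CV_infinite. intros x _. eexists; apply hd.
  - intros x hx. rewrite (is_pseries_unique _ _ _ (hd x)). apply hg, hx. }
assert (hc0 : c O = coulombC L eta).
{ rewrite <- (PSeries_0 c). fold g.
  assert (l1 : filterlim g (at_right 0) (locally (g 0))).
  { eapply filterlim_filter_le_1. 2: apply (ex_derive_continuous g); eexists; apply d0.
    intros P [e he]. exists e. auto. }
  assert (l2 : filterlim g (at_right 0) (locally (coulombC L eta))).
  { apply filterlim_ext_loc with (2 := hnorm).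
    exists (mkposreal 1 Rlt_0_1). intros t _ ht. apply q, ht. }
  exact (filterlim_locally_unique (K := R_AbsRing) (V := R_NormedModule) (F := at_right 0)
    g (g 0) (coulombC L eta) l1 l2). }
intros rho hr. rewrite hF by exact hr. f_equal. unfold g. apply PSeries_ext.
apply coulomb_coef_unique; [exact hL|exact hc0| |].
- assert (h := hd0 O). unfold d, PS_plus, PS_scal, PS_incr_1, PS_derive, plus, scal, zero in h; simpl in h.
  unfold mult in h; simpl in h. lra.
- intros n. assert (h := hd0 (S n)). unfold d, PS_plus, PS_scal, PS_incr_1, PS_derive, plus, scal, zero in h.
  cbn -[INR] in h. unfold mult in h; cbn -[INR] in h. rewrite !S_INR in h. lra.
Qed.

Lemma coulomb_solution_Derive (L eta : R) (F : R -> R) : -1 < L ->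
  coulomb_solution L eta F ->
  forall rho, 0 < rho ->
    Derive F rho = Rpower rho (L + 1) *
      ((L + 1) / rho * PSeries (coulomb_coef L eta (coulombC L eta)) rho
       + PSeries (PS_derive (coulomb_coef L eta (coulombC L eta))) rho).
Proof.
intros hL hF rho hr. apply is_derive_unique.
apply is_derive_ext_loc with
  (fun t => Rpower t (L + 1) * PSeries (coulomb_coef L eta (coulombC L eta)) t).
- apply locally_pos; [exact hr|]. intros t ht. symmetry. apply coulomb_solution_series; assumption.
- apply is_derive_Rpower_mult; [exact hr|]. apply is_derive_PSeries.
  rewrite coulomb_coef_entire by exact hL. exact I.
Qed.

(** * Ladder relations and the Turan determinant *)

Definition coulomb_q (L eta rho : R) : R := 1 - 2 * eta / rho - L * (L + 1) / rho ^ 2.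

Lemma coulomb_solution_derive2 (L eta : R) (F : R -> R) (rho : R) :
  coulomb_solution L eta F -> 0 < rho ->
  is_derive F rho (Derive F rho) /\
  is_derive (Derive F) rho (- coulomb_q L eta rho * F rho).
Proof.
intros h hr. destruct (coulomb_ode _ _ _ h rho hr) as (e1 & e2 & e3).
split; [apply Derive_correct, e1|].
replace (- coulomb_q L eta rho * F rho) with (Derive (Derive F) rho).
- apply Derive_correct, e2.
- change (Derive_n F 2 rho) with (Derive (Derive F) rho) in e3. unfold coulomb_q. lra.
Qed.

(** Both sides are rho^L times an entire series. The right-hand side has coefficients
    d_n = L (2L+1+n) a_n + eta a_(n-1), where a is the sequence of F; they satisfy the
    recurrence of index L - 1, and coulombC_step matches the constant terms. *)
Lemma coulomb_solution_lowering (L eta : R) (Fl F : R -> R) : 0 < L -> 0 <= eta ->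
  coulomb_solution (L - 1) eta Fl -> coulomb_solution L eta F ->
  forall rho, 0 < rho ->
    sqrt (L ^ 2 + eta ^ 2) * Fl rho = (L ^ 2 / rho + eta) * F rho + L * Derive F rho.
Proof.
intros hL heta hFl hF rho hr.
rewrite (coulomb_solution_series (L - 1) eta Fl ltac:(lra) hFl rho hr).
rewrite (coulomb_solution_series L eta F ltac:(lra) hF rho hr).
rewrite (coulomb_solution_Derive L eta F ltac:(lra) hF rho hr).
set (k := sqrt (L ^ 2 + eta ^ 2)).
assert (hk : 0 < k) by (apply sqrt_lt_R0; nra).
assert (hC := coulombC_step L eta hL heta). fold k in hC.
set (C0 := coulombC L eta) in *. set (a := coulomb_coef L eta C0).
destruct (coulomb_coef_rec L eta C0 ltac:(lra)) as (r1 & r2). fold a in r1, r2.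
set (d := fun n => (L * (2 * L + 1 + INR n) * a n + eta * PS_incr_1 a n)).
assert (ha0 : a O = C0) by reflexivity.
assert (hda : forall n, d n / k = coulomb_coef (L - 1) eta (coulombC (L - 1) eta) n).
{ apply coulomb_coef_unique; [lra| | |].
  - unfold d, PS_incr_1, zero; simpl. rewrite ha0. apply Rmult_eq_reg_l with k; [|lra]. rewrite hC. field. lra.
  - unfold d, PS_incr_1, zero; simpl.
    replace ((2 * (L - 1) + 2) * ((L * (2 * L + 1 + 1) * a 1%nat + eta * a O) / k))
      with ((2 * L * L * ((2 * L + 2) * a 1%nat) + 2 * L * eta * a O) / k) by (field; lra).
    rewrite r1. field. lra.
  - intros n. unfold d. change (PS_incr_1 a (S (S n))) with (a (S n)). change (PS_incr_1 a (S n)) with (a n).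
    apply Rmult_eq_reg_l with k; [|lra].
    assert (e2 := r2 n). rewrite !S_INR.
    (* one more recurrence step turns the a (S n) term into a n and a (n-1) *)
    assert (e1 : (INR n + 1) * (INR n + 2 * L + 2) * a (S n) = 2 * eta * a n - PS_incr_1 a n).
    { destruct n as [|n]; [unfold PS_incr_1, zero; simpl; lra|].
      rewrite S_INR. change (PS_incr_1 a (S n)) with (a n). rewrite <- r2. ring. }
    set (N := INR n) in *. set (a2 := a (S (S n))) in *. set (a1 := a (S n)) in *.
    set (a0 := a n) in *. set (am := PS_incr_1 a n) in *.
    replace (k * ((N + 2) * (N + 2 * (L - 1) + 3) * ((L * (2 * L + 1 + (N + 1 + 1)) * a2 + eta * a1) / k)))
      with (L * (N + 2 * L + 1) * ((N + 2) * (N + 2 * L + 3) * a2) + (N + 2) * (N + 2 * L + 1) * eta * a1)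
      by (field; lra).
    replace (k * (2 * eta * ((L * (2 * L + 1 + (N + 1)) * a1 + eta * a0) / k) - (L * (2 * L + 1 + N) * a0 + eta * am) / k))
      with (2 * eta * (L * (2 * L + 1 + (N + 1)) * a1 + eta * a0) - (L * (2 * L + 1 + N) * a0 + eta * am)) by (field; lra).
    rewrite e2.
    replace am with (2 * eta * a0 - (N + 1) * (N + 2 * L + 2) * a1) by lra. ring. }
assert (cv : CV_radius a = p_infty) by (apply coulomb_coef_entire; lra).
assert (s0 : is_pseries a rho (PSeries a rho)) by (apply PSeries_correct, CV_radius_inside; rewrite cv; exact I).
assert (s1 : is_pseries (PS_derive a) rho (PSeries (PS_derive a) rho)).
{ apply PSeries_correct, CV_radius_inside; rewrite CV_radius_derive, cv; exact I. }
assert (HS := is_pseries_plus _ _ _ _ _ (is_pseries_scal (L * (2 * L + 1)) _ _ _ (Rmult_comm _ _) s0)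
  (is_pseries_plus _ _ _ _ _ (is_pseries_scal eta _ _ _ (Rmult_comm _ _) (is_pseries_incr_1 _ _ _ s0))
     (is_pseries_scal L _ _ _ (Rmult_comm _ _) (is_pseries_incr_1 _ _ _ s1)))).
apply is_pseries_unique in HS.
rewrite (PSeries_ext _ (PS_scal k (coulomb_coef (L - 1) eta (coulombC (L - 1) eta)))) in HS.
2:{ intros n. unfold PS_plus at 1, PS_plus at 1, PS_scal. rewrite <- hda. unfold d, plus, scal; simpl.
  unfold mult; simpl.
  assert (e : PS_incr_1 (PS_derive a) n = INR n * a n).
  { destruct n as [|n]; [unfold PS_incr_1, zero; simpl; ring|reflexivity]. }
  rewrite e. field. lra. }
rewrite PSeries_scal in HS. unfold plus, scal in HS; simpl in HS. unfold mult in HS; simpl in HS.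
replace (L - 1 + 1) with L by ring.
replace (Rpower rho (L + 1)) with (Rpower rho L * rho) by (rewrite Rpower_plus, Rpower_1 by exact hr; reflexivity).
rewrite (Rmult_comm (Rpower rho L) (PSeries _ _)), <- Rmult_assoc, HS. field. lra.
Qed.

Lemma regular_coulomb_solution (L eta : R) (F : R -> R) : -1 < L ->
  regular_coulomb L eta F -> coulomb_solution L eta F.
Proof.
intros hL h. unfold regular_coulomb in h. destruct (Req_EM_T L (-1)); [lra|exact h].
Qed.

(** At L = 0 the function of index -1 is F_0 itself and the relation reads
    |eta| F_0 = eta F_0. *)
Lemma coulomb_lowering (L eta : R) (Fl F : R -> R) : 0 <= L -> 0 <= eta ->
  regular_coulomb (L - 1) eta Fl -> coulomb_solution L eta F ->
  forall rho, 0 < rho ->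
    sqrt (L ^ 2 + eta ^ 2) * Fl rho = (L ^ 2 / rho + eta) * F rho + L * Derive F rho.
Proof.
intros [hL|<-] heta hFl hF rho hr.
- apply coulomb_solution_lowering; try assumption. apply regular_coulomb_solution; [lra|exact hFl].
- unfold regular_coulomb in hFl. destruct (Req_EM_T (0 - 1) (-1)) as [_|n]; [|exfalso; apply n; lra].
  rewrite (coulomb_solution_series 0 eta Fl ltac:(lra) hFl rho hr).
  rewrite (coulomb_solution_series 0 eta F ltac:(lra) hF rho hr).
  replace (0 ^ 2 + eta ^ 2) with (eta ^ 2) by ring. rewrite sqrt_pow2 by exact heta. field. lra.
Qed.

(** The lowering relation at L + 1 writes k F as the first order operator
    (L+1)^2 / rho + eta + (L+1) d/drho applied to F_(L+1), where
    k = sqrt ((L+1)^2 + eta^2). Applying (L+1)^2 / rho + eta - (L+1) d/drho and replacing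
    F_(L+1)'' by the equation gives k^2 F_(L+1): the two operators factor the equation. *)
Lemma coulomb_raising (L eta : R) (F Fp : R -> R) : 0 <= L -> 0 <= eta ->
  coulomb_solution L eta F -> coulomb_solution (L + 1) eta Fp ->
  forall rho, 0 < rho ->
    sqrt ((L + 1) ^ 2 + eta ^ 2) * Fp rho
      = ((L + 1) ^ 2 / rho + eta) * F rho - (L + 1) * Derive F rho.
Proof.
intros hL heta hF hFp rho hr.
assert (low : forall t, 0 < t -> sqrt ((L + 1) ^ 2 + eta ^ 2) * F t
   = ((L + 1) ^ 2 / t + eta) * Fp t + (L + 1) * Derive Fp t).
{ apply coulomb_solution_lowering; try lra; try assumption. replace (L + 1 - 1) with L by ring. exact hF. }
set (k := sqrt ((L + 1) ^ 2 + eta ^ 2)) in *.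
assert (hk2 : k ^ 2 = (L + 1) ^ 2 + eta ^ 2) by (unfold k; rewrite pow2_sqrt; nra).
assert (hk : 0 < k) by (apply sqrt_lt_R0; nra).
destruct (coulomb_solution_derive2 _ _ _ rho hF hr) as (a1 & _).
destruct (coulomb_solution_derive2 _ _ _ rho hFp hr) as (b1 & b2).
assert (e : k * Derive F rho = - (L + 1) ^ 2 / rho ^ 2 * Fp rho + ((L + 1) ^ 2 / rho + eta) * Derive Fp rho
    + (L + 1) * (- coulomb_q (L + 1) eta rho * Fp rho)).
{ rewrite <- (Derive_scal F k rho). apply is_derive_unique.
  apply is_derive_ext_loc with (fun t => ((L + 1) ^ 2 / t + eta) * Fp t + (L + 1) * Derive Fp t).
  - apply locally_pos; [exact hr|]. intros t ht. symmetry; apply low, ht.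
  - auto_derive; [split; [lra|split; [eexists; exact b1|split; [eexists; exact b2|exact I]]]|].
    change (Derive (fun x => Derive Fp x) rho) with (Derive (Derive Fp) rho).
    change (Derive (fun x => Fp x) rho) with (Derive Fp rho).
    rewrite (is_derive_unique _ _ _ b2). field. lra. }
apply Rmult_eq_reg_l with k; [|lra].
replace (k * (((L + 1) ^ 2 / rho + eta) * F rho - (L + 1) * Derive F rho))
  with (((L + 1) ^ 2 / rho + eta) * (k * F rho) - (L + 1) * (k * Derive F rho)) by ring.
rewrite (low rho hr), e.
replace (k * (k * Fp rho)) with (k ^ 2 * Fp rho) by ring. rewrite hk2. unfold coulomb_q. field. lra.
Qed.

(** The two ladder relations turn the product of the neighbours into a quadratic form in F
    and F', from which every term in eta except 2 eta F^2 / rho cancels. *)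
Lemma coulomb_turan_Psi (L eta : R) (Fm F Fp : R -> R) : 0 <= L -> 0 < eta ->
  regular_coulomb (L - 1) eta Fm -> regular_coulomb L eta F -> regular_coulomb (L + 1) eta Fp ->
  forall rho, 0 < rho -> F rho <> 0 ->
    turan_coulomb L eta Fm F Fp rho = L * (L + 1) * coulomb_Psi L eta F rho * F rho ^ 2.
Proof.
intros hL heta hFm hF hFp rho hr hn.
apply regular_coulomb_solution in hF; [|lra]. apply regular_coulomb_solution in hFp; [|lra].
assert (lo := coulomb_lowering L eta Fm F hL ltac:(lra) hFm hF rho hr).
assert (up := coulomb_raising L eta F Fp hL ltac:(lra) hF hFp rho hr).
unfold turan_coulomb. rewrite sqrt_mult by nra.
replace (sqrt (L ^ 2 + eta ^ 2) * sqrt ((L + 1) ^ 2 + eta ^ 2) * Fm rho * Fp rho)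
  with ((sqrt (L ^ 2 + eta ^ 2) * Fm rho) * (sqrt ((L + 1) ^ 2 + eta ^ 2) * Fp rho)) by ring.
rewrite lo, up. unfold coulomb_Psi, coulomb_y. field. lra.
Qed.

(** * Positive zeros *)

(** What the study of zeros and of Psi uses of a Coulomb function. The linear bound near the
    origin records F(0+) = 0, which excludes zeros before 2 eta. *)
Record coulomb_wave (L eta : R) (F : R -> R) : Prop := {
  wave_L : 0 <= L;
  wave_eta : 0 < eta;
  wave_derive : forall rho, 0 < rho -> is_derive F rho (Derive F rho);
  wave_derive2 : forall rho, 0 < rho ->
    is_derive (Derive F) rho (- coulomb_q L eta rho * F rho);
  wave_origin : exists e K, 0 < e /\ forall rho, 0 < rho < e -> 0 < F rho <= K * rho
}.

(** Positivity near the origin is the positivity of the normalizing constant, hence the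
    nonvanishing of Gamma. *)
Lemma regular_coulomb_wave (L eta : R) (F : R -> R) : 0 <= L -> 0 < eta ->
  regular_coulomb L eta F -> coulomb_wave L eta F.
Proof.
intros hL heta hF. apply regular_coulomb_solution in hF; [|lra].
assert (hC := coulombC_pos L eta hL ltac:(lra)).
split; [exact hL|exact heta| | |].
- intros rho hr. apply (coulomb_solution_derive2 _ _ _ rho hF hr).
- intros rho hr. apply (coulomb_solution_derive2 _ _ _ rho hF hr).
- assert (h := proj1 (filterlim_locally _ _) (coulomb_normalized _ _ _ hF) (mkposreal _ hC)).
  destruct h as (e & he). set (C0 := coulombC L eta) in *.
  exists (Rmin e 1), (2 * C0). split; [apply Rmin_glb_lt; [apply cond_pos|lra]|].
  intros rho hr. assert (h1 := Rmin_l e 1). assert (h2 := Rmin_r e 1).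
  assert (b := he rho). unfold ball in b; simpl in b. unfold AbsRing_ball, abs, minus, plus, opp in b; simpl in b.
  specialize (b ltac:(apply Rabs_def1; lra) ltac:(lra)). apply Rabs_def2 in b.
  assert (hp := Rpower_pos rho (L + 1)).
  assert (hp1 : Rpower rho (L + 1) <= rho).
  { rewrite Rpower_plus, Rpower_1 by lra.
    assert (Rpower rho L <= 1).
    { assert (ln rho <= 0) by (rewrite <- ln_1; apply ln_le; lra).
      unfold Rpower.
      destruct (Rle_lt_or_eq_dec (L * ln rho) 0) as [h0|h0]; [nra| |].
      - rewrite <- exp_0. left. apply exp_increasing, h0.
      - rewrite h0, exp_0. lra. }
    nra. }
  set (w := F rho / Rpower rho (L + 1)) in *.
  assert (hw : F rho = w * Rpower rho (L + 1)) by (unfold w; field; lra).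
  rewrite hw. split; [apply Rmult_lt_0_compat; lra|]. nra.
Qed.

(** Gronwall: F^2 + F'^2 times an exponential is nondecreasing, so it vanishes to the left of
    a double zero, whereas F > 0 near the origin. *)
Lemma wave_no_double_zero {L eta F} (W : coulomb_wave L eta F) (r : R) :
  0 < r -> F r = 0 -> Derive F r <> 0.
Proof.
intros hr F0 D0. destruct W as [hL heta hF hD (e & K0 & he & h0)].
set (s := Rmin e r / 2).
assert (hs : 0 < s < e /\ s < r).
{ unfold s. assert (0 < Rmin e r) by (apply Rmin_glb_lt; lra).
  assert (h1 := Rmin_l e r). assert (h2 := Rmin_r e r). lra. }
(* K bounds 1 - q on [s, r], and |2 F F'| <= F ^ 2 + F' ^ 2 *)
set (K := 2 * eta / s + L * (L + 1) / s ^ 2).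
set (V := fun t => (F t ^ 2 + Derive F t ^ 2) * exp (K * t)).
set (V' := fun t => (2 * F t * Derive F t * (1 - coulomb_q L eta t)
               + K * (F t ^ 2 + Derive F t ^ 2)) * exp (K * t)).
assert (hV : forall t, s <= t <= r -> is_derive V t (V' t)).
{ intros t ht. unfold V, V'.
  assert (a1 := hF t ltac:(lra)). assert (a2 := hD t ltac:(lra)).
  auto_derive. { split; [eexists; exact a1|]. split; [eexists; exact a2|exact I]. }
  change (Derive (fun x => Derive F x) t) with (Derive (Derive F) t).
  rewrite (is_derive_unique _ _ _ a2). change (Derive (fun x => F x) t) with (Derive F t). ring. }
destruct (is_derive_MVT V V' s r) as (c & hc & ec); [lra|exact hV|].
assert (hV' : 0 <= V' c).
{ unfold V'. apply Rmult_le_pos; [|left; apply exp_pos].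
  assert (hq : 0 <= 1 - coulomb_q L eta c <= K).
  { unfold coulomb_q, K.
    assert (0 <= 2 * eta / c <= 2 * eta / s).
    { split. apply Rdiv_le_0_compat; lra. apply Rmult_le_compat_l; [lra|].
      apply Rinv_le_contravar; lra. }
    assert (0 <= L * (L + 1) / c ^ 2 <= L * (L + 1) / s ^ 2).
    { split. apply Rdiv_le_0_compat; [nra|apply pow_lt; lra].
      apply Rmult_le_compat_l; [nra|].
      apply Rinv_le_contravar; [apply pow_lt; lra|apply pow_incr; lra]. }
    lra. }
  set (k := 1 - coulomb_q L eta c) in *. set (u := F c). set (v := Derive F c).
  assert (0 <= k * (u + v) ^ 2) by (apply Rmult_le_pos; [lra|apply pow2_ge_0]).
  assert (0 <= (K - k) * (u ^ 2 + v ^ 2)) by (apply Rmult_le_pos; [lra|nra]).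
  nra. }
assert (V s <= V r) by nra.
assert (0 < V s).
{ unfold V. apply Rmult_lt_0_compat; [|apply exp_pos].
  assert (h := h0 s ltac:(lra)). assert (h2 := pow2_ge_0 (Derive F s)). nra. }
unfold V in *. rewrite F0, D0 in H. nra.
Qed.

Lemma wave_simple_zero {L eta F} (W : coulomb_wave L eta F) (r : R) :
  0 < r -> F r = 0 ->
  exists d, 0 < d /\
    forall t, t <> r -> r - d < t < r + d -> 0 < Derive F r * F t * (t - r).
Proof.
intros hr F0. apply simple_zero_sign; [apply (wave_derive _ _ _ W), hr|exact F0|].
apply (wave_no_double_zero W); assumption.
Qed.

(** Riccati form of Sturm comparison: if F had no further zero, then far enough out w = F'/F would satisfy
    w' = - q - w^2 <= - (1/4 + w^2), so atan (2 w) would decrease at speed at least 1/2 forever. *)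
Lemma wave_oscillates {L eta F} (W : coulomb_wave L eta F) (M : R) :
  exists rho, M < rho /\ 0 < rho /\ F rho = 0.
Proof.
destruct (Classical_Prop.classic (exists rho, M < rho /\ 0 < rho /\ F rho = 0)) as [h|h]; [exact h|exfalso].
destruct W as [hL heta hF hD _].
assert (hn : forall rho, M < rho -> 0 < rho -> F rho <> 0) by (intros rho ? ? ?; apply h; eauto).
(* beyond s, 2 eta / rho <= 1/4 and L (L + 1) / rho ^ 2 <= 1/4 *)
set (s := Rmax M 0 + 8 * eta + 2 * (L + 1) + 1).
assert (hs : M < s /\ 0 < s /\ 8 * eta + 2 * (L + 1) + 1 <= s).
{ unfold s. assert (a := Rmax_l M 0). assert (b := Rmax_r M 0). repeat split; lra. }
assert (hq : forall t, s <= t -> 1/4 <= coulomb_q L eta t).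
{ intros t ht. unfold coulomb_q.
  assert (2 * eta / t <= 1/4) by (apply Rle_div_l; lra).
  assert (L * (L + 1) / t ^ 2 <= 1/4) by (apply Rle_div_l; [apply pow_lt; lra|nra]).
  lra. }
set (phi := fun t => atan (2 * (Derive F t / F t)) + t / 2).
set (phi' := fun t => / (1 + (2 * (Derive F t / F t)) ^ 2)
     * (2 * (- coulomb_q L eta t - (Derive F t / F t) ^ 2)) + 1 / 2).
assert (hphi : forall t, s <= t -> is_derive phi t (phi' t)).
{ intros t ht. unfold phi, phi'.
  assert (a1 := hF t ltac:(lra)). assert (a2 := hD t ltac:(lra)).
  assert (a3 : F t <> 0) by (apply hn; lra).
  assert (a4 : is_derive (fun t => 2 * (Derive F t / F t)) t (2 * (- coulomb_q L eta t - (Derive F t / F t) ^ 2))).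
  { auto_derive. { split; [eexists; exact a2|]. split; [eexists; exact a1|]. split; [exact a3|exact I]. }
    change (Derive (fun x => Derive F x) t) with (Derive (Derive F) t).
    rewrite (is_derive_unique _ _ _ a2). change (Derive (fun x => F x)) with (Derive F). field. exact a3. }
  evar_last. apply (is_derive_plus (fun t => atan (2 * (Derive F t / F t))) (fun t => t / 2)).
  apply (is_derive_comp atan (fun t => 2 * (Derive F t / F t)) t); [apply is_derive_atan|exact a4].
  auto_derive; [exact I|reflexivity].
  unfold plus, scal; simpl; unfold mult; simpl. unfold Rsqr. field.
  split; [exact a3|].
  assert (0 < F t * F t) by nra. assert (0 <= Derive F t * Derive F t) by nra. nra. }
assert (hdec : forall t, s < t -> phi t <= phi s).
{ intros t ht. destruct (is_derive_MVT phi phi' s t ht) as (c & hc & ec).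
  { intros u hu. apply hphi; lra. }
  enough (phi' c <= 0) by nra. unfold phi'. set (w := Derive F c / F c).
  assert (0 < 1 + (2 * w) ^ 2) by nra.
  replace (/ (1 + (2 * w) ^ 2) * (2 * (- coulomb_q L eta c - w ^ 2)) + 1 / 2)
    with ((1/2 * (1 + (2 * w)^2) + 2 * (- coulomb_q L eta c - w ^ 2)) / (1 + (2 * w) ^ 2)) by (field; lra).
  assert (hc' := hq c ltac:(lra)).
  apply Rle_div_l; [lra|]. nra. }
assert (b1 := atan_bound (2 * (Derive F s / F s))).
(* atan has total variation PI, so a length 2 PI is too long *)
specialize (hdec (s + 2 * PI + 1)).
assert (b2 := atan_bound (2 * (Derive F (s + 2 * PI + 1) / F (s + 2 * PI + 1)))).
assert (hp := PI_RGT_0). unfold phi in hdec. assert (b3 := hdec ltac:(lra)). lra.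
Qed.

Definition next_zero (F : R -> R) (r s : R) : Prop :=
  r < s /\ F s = 0 /\ forall t, r < t < s -> F t <> 0.

(** The origin is allowed as a starting point, so that the first zero is also a next zero. *)
Lemma wave_isolated_right {L eta F} (W : coulomb_wave L eta F) (r : R) :
  r = 0 \/ (0 < r /\ F r = 0) ->
  exists d, 0 < d /\ forall t, r < t < r + d -> F t <> 0.
Proof.
intros [->|[hr F0]].
- destruct (wave_origin _ _ _ W) as (e & K & he & h). exists e. split; [exact he|].
  intros t ht. assert (h1 := h t ltac:(lra)). lra.
- destruct (wave_simple_zero W r hr F0) as (d & hd & h). exists d. split; [exact hd|].
  intros t ht e. assert (h1 := h t ltac:(lra) ltac:(lra)). rewrite e in h1. lra.
Qed.

Lemma wave_next_zero {L eta F} (W : coulomb_wave L eta F) (r : R) :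
  r = 0 \/ (0 < r /\ F r = 0) -> exists s, next_zero F r s.
Proof.
intros hr. destruct (wave_isolated_right W r hr) as (d & hd & hiso).
destruct (wave_oscillates W r) as (z & hz & hz0 & Fz).
(* the next zero is the end of the longest zero-free interval starting at r *)
set (S := fun t => r < t /\ forall s, r < s < t -> F s <> 0).
destruct (completeness S) as (m & hub & hlub).
{ exists z. intros t [ht hS]. destruct (Rle_or_lt t z) as [|hzt]; [assumption|].
  exfalso. apply (hS z); auto. }
{ exists (r + d). split; [lra|exact hiso]. }
assert (hm : r + d <= m) by (apply hub; split; [lra|exact hiso]).
assert (hbelow : forall t, r < t < m -> F t <> 0).
{ intros t ht Ft.
  assert (m <= t); [|lra]. apply hlub. intros u [hu hS].
  destruct (Rle_or_lt u t) as [|htu]; [assumption|]. exfalso. apply (hS t); [lra|exact Ft]. }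
exists m. split; [lra|split; [|exact hbelow]].
destruct (Req_dec (F m) 0) as [|Fm]; [assumption|exfalso].
assert (hm0 : 0 < m) by (destruct hr as [->|[h _]]; lra).
assert (hc : continuity_pt F m) by (eapply is_derive_continuity_pt, (wave_derive _ _ _ W), hm0).
destruct (continuous_neq_0 F m hc Fm) as (e & he).
assert (he' := cond_pos e).
assert (m + e / 2 <= m); [|lra].
apply hub. split; [lra|]. intros t ht.
destruct (Rlt_or_le t m) as [h|h]; [apply hbelow; lra|].
replace t with (m + (t - m)) by ring. apply he. apply Rabs_def1; lra.
Qed.

Lemma wave_zero_sequence {L eta F} (W : coulomb_wave L eta F) :
  exists x : nat -> R, x O = 0 /\ (forall n, next_zero F (x n) (x (S n))).
Proof.
destruct (functional_choice (fun r s => r = 0 \/ (0 < r /\ F r = 0) -> next_zero F r s)) as (nx & hnx).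
{ intros r. destruct (Classical_Prop.classic (r = 0 \/ (0 < r /\ F r = 0))) as [h|h].
  - destruct (wave_next_zero W r h) as (s & hs). exists s; auto.
  - exists 0. tauto. }
exists (fun n => Nat.iter n nx 0). split; [reflexivity|].
assert (H : forall n, Nat.iter n nx 0 = 0 \/ (0 < Nat.iter n nx 0 /\ F (Nat.iter n nx 0) = 0)).
{ induction n as [|n IH]; [left; reflexivity|right].
  destruct (hnx _ IH) as (h1 & h2 & _). simpl. split; [|exact h2].
  destruct IH as [e|[h _]]; lra. }
intros n. exact (hnx _ (H n)).
Qed.

(** A finite limit of zeros would be a zero that is not isolated, but zeros are simple. *)
Lemma zero_sequence_unbounded {L eta F} (W : coulomb_wave L eta F) (x : nat -> R) :
  x O = 0 -> (forall n, next_zero F (x n) (x (S n))) -> forall M, exists n, M < x n.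
Proof.
intros x0 hx M.
destruct (Classical_Prop.classic (exists n, M < x n)) as [h|h]; [exact h|exfalso].
assert (hM : forall n, x n <= M).
{ intros n. destruct (Rle_or_lt (x n) M); [assumption|exfalso; eauto]. }
assert (hg : Un_growing x) by (intros n; left; apply (hx n)).
destruct (growing_cv x hg) as (l & hl).
{ exists M. intros t (n & ->). apply hM. }
assert (hle := growing_ineq x l hg hl).
assert (hl0 : 0 < l) by (assert (a := hle 1%nat); destruct (hx O); lra).
assert (Fl : F l = 0).
{ apply is_lim_seq_Reals in hl.
  assert (hc : continuity_pt F l) by (eapply is_derive_continuity_pt, (wave_derive _ _ _ W), hl0).
  assert (h1 := is_lim_seq_continuous F x l hc hl). apply is_lim_seq_incr_1 in h1.
  apply is_lim_seq_unique in h1.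
  rewrite (Lim_seq_ext _ (fun _ => 0)), Lim_seq_const in h1.
  - injection h1; auto.
  - intros n. apply (hx n). }
destruct (wave_simple_zero W l hl0 Fl) as (d & hd & hs).
destruct (hl d hd) as (N & hN). specialize (hN (S N) ltac:(lia)).
unfold Rdist in hN. apply Rabs_def2 in hN.
assert (a := hle (S (S N))). destruct (hx (S N)) as (b & _ & _). destruct (hx N) as (_ & b' & _).
assert (c := hs (x (S N)) ltac:(lra) ltac:(lra)). rewrite b' in c. lra.
Qed.

Lemma zero_sequence_positive_zeros {L eta F} (W : coulomb_wave L eta F) (x : nat -> R) :
  x O = 0 -> (forall n, next_zero F (x n) (x (S n))) -> positive_zeros F x.
Proof.
intros x0 hx.
assert (hpos : forall n, 0 < x (S n)).
{ induction n as [|n IH]. destruct (hx O); lra. destruct (hx (S n)); lra. }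
split.
- intros [|n] hn; [lia|]. split; [apply hpos|apply (hx (S n))].
- intros rho hr. split.
  + intros F0. destruct (zero_sequence_unbounded W x x0 hx rho) as (m & hm).
    (* descend from an index past rho to the interval holding rho *)
    induction m as [|m IH]; [lra|].
    destruct (Rtotal_order rho (x m)) as [h|[h|h]].
    * apply IH, h.
    * destruct m as [|m]; [lra|]. exists (S m). split; [lia|auto].
    * exfalso. apply (proj2 (proj2 (hx m)) rho); auto.
  + intros ([|n] & hn & <-); [lia|]. apply (hx n).
Qed.

(** On (0, 2 eta] the coefficient q is nonpositive, so F is convex as long as it is positive;
    a positive convex function that reaches 0 with negative slope has decreased all along,
    which is impossible as F(0+) = 0. *)
Lemma wave_first_zero {L eta F} (W : coulomb_wave L eta F) (s : R) :
  next_zero F 0 s -> 2 * eta < s.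
Proof.
intros (hs & Fs & hn). destruct (Rlt_or_le (2 * eta) s) as [|hle]; [assumption|exfalso].
assert (Ds := wave_no_double_zero W s hs Fs).
destruct (wave_simple_zero W s hs Fs) as (d & hd & hd').
destruct W as [hL heta hF hD (e & K & he & h0)].
assert (hpos : forall t, 0 < t < s -> 0 < F t).
{ intros t ht. destruct (Rlt_or_le 0 (F t)) as [|h]; [assumption|exfalso].
  assert (hFt : F t < 0) by (assert (a := hn t ht); lra).
  set (u := Rmin e t / 2).
  assert (hu : 0 < u < e /\ u < t).
  { unfold u. assert (0 < Rmin e t) by (apply Rmin_glb_lt; lra).
    assert (h1 := Rmin_l e t). assert (h2 := Rmin_r e t). lra. }
  assert (hFu := h0 u ltac:(lra)).
  destruct (IVT_interv (fun v => - F v) u t) as (z & hz & ez); [|lra|lra|lra|].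
  - intros v hv. apply continuity_pt_opp. eapply is_derive_continuity_pt, hF; lra.
  - assert (z <> t) by (intros ->; lra). apply (hn z); lra. }
assert (hDs : Derive F s < 0).
{ set (t := Rmax (s - d / 2) (s / 2)).
  assert (ht : s - d < t < s /\ 0 < t).
  { unfold t. assert (a := Rmax_l (s - d / 2) (s / 2)). assert (b := Rmax_r (s - d / 2) (s / 2)).
    assert (Rmax (s - d / 2) (s / 2) < s) by (apply Rmax_lub_lt; lra). lra. }
  assert (a := hd' t ltac:(lra) ltac:(lra)). assert (b := hpos t ltac:(lra)).
  assert (0 < (- Derive F s) * (F t * (s - t))) by lra.
  assert (0 < F t * (s - t)) by (apply Rmult_lt_0_compat; lra). nra. }
(* F is convex on (0, s], where q <= 0 *)
assert (hDn : forall t, 0 < t <= s -> Derive F t <= Derive F s).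
{ intros t ht. destruct (Req_dec t s) as [->|hne]; [lra|].
  destruct (is_derive_MVT (Derive F) (fun v => - coulomb_q L eta v * F v) t s) as (c & hc & ec); [lra| |].
  - intros v hv. apply hD; lra.
  - assert (hq : coulomb_q L eta c <= 0).
    { unfold coulomb_q. assert (1 <= 2 * eta / c) by (apply Rle_div_r; lra).
      assert (0 <= L * (L + 1) / c ^ 2) by (apply Rdiv_le_0_compat; [nra|apply pow_lt; lra]). lra. }
    assert (hFc := hpos c ltac:(lra)).
    assert (0 <= - coulomb_q L eta c * F c) by (apply Rmult_le_pos; lra). nra. }
(* a decreasing positive function cannot tend to 0 at the origin *)
assert (hdec : forall u t, 0 < u < t -> t <= s -> F t < F u).
{ intros u t hu ht. destruct (is_derive_MVT F (Derive F) u t) as (c & hc & ec); [lra| |].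
  - intros v hv. apply hF; lra.
  - assert (a := hDn c ltac:(lra)). nra. }
set (t := Rmin e s / 2).
assert (ht : 0 < t < e /\ t < s).
{ unfold t. assert (0 < Rmin e s) by (apply Rmin_glb_lt; lra).
  assert (h1 := Rmin_l e s). assert (h2 := Rmin_r e s). lra. }
assert (hFt := h0 t ltac:(lra)).
assert (hK : 0 < K) by nra.
set (u := Rmin (t / 2) (F t / K)).
assert (hu : 0 < u < t /\ u <= F t / K).
{ unfold u. assert (0 < F t / K) by (apply Rdiv_lt_0_compat; lra).
  assert (0 < Rmin (t / 2) (F t / K)) by (apply Rmin_glb_lt; lra).
  assert (h1 := Rmin_l (t / 2) (F t / K)). assert (h2 := Rmin_r (t / 2) (F t / K)). lra. }
assert (a := h0 u ltac:(lra)). assert (b := hdec u t ltac:(lra) ltac:(lra)).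
assert (u * K <= F t) by (apply Rle_div_r; lra). lra.
Qed.

Lemma zero_sequence_beyond {L eta F} (W : coulomb_wave L eta F) (x : nat -> R) :
  x O = 0 -> (forall n, next_zero F (x n) (x (S n))) -> forall n, 2 * eta < x (S n).
Proof.
intros x0 hx. induction n as [|n IH].
- apply (wave_first_zero W). rewrite <- x0. apply hx.
- destruct (hx (S n)). lra.
Qed.

(** * The function Psi between consecutive zeros *)

(** This is the Riccati equation of y. It makes the positivity of Psi the same thing as the
    monotonicity of y. *)
Lemma is_derive_coulomb_y {L eta F} (W : coulomb_wave L eta F) (rho : R) :
  0 < rho -> F rho <> 0 ->
  is_derive (coulomb_y F) rho (- rho * coulomb_Psi L eta F rho).
Proof.
intros hr hn. assert (a1 := wave_derive _ _ _ W rho hr). assert (a2 := wave_derive2 _ _ _ W rho hr).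
unfold coulomb_y.
auto_derive. { split; [eexists; exact a2|split; [eexists; exact a1|split; [exact hn|exact I]]]. }
change (Derive (fun x => Derive F x) rho) with (Derive (Derive F) rho).
change (Derive (fun x => F x) rho) with (Derive F rho).
rewrite (is_derive_unique _ _ _ a2). unfold coulomb_Psi, coulomb_y, coulomb_q. field. lra.
Qed.

(** The factor in Psi' = - (2/rho) ((1+y) Psi - 1 + eta/rho); it is positive where Psi decreases. *)
Definition Psi_slope (L eta : R) (F : R -> R) (rho : R) : R :=
  (1 + coulomb_y F rho) * coulomb_Psi L eta F rho - 1 + eta / rho.

Lemma is_derive_coulomb_Psi {L eta F} (W : coulomb_wave L eta F) (rho : R) :
  0 < rho -> F rho <> 0 ->
  is_derive (coulomb_Psi L eta F) rho (- (2 / rho) * Psi_slope L eta F rho).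
Proof.
intros hr hn. assert (a := is_derive_coulomb_y W rho hr hn).
unfold coulomb_Psi at 1.
auto_derive. { split; [lra|split; [eexists; exact a|split; [|exact I]]]. nra. }
change (Derive (fun x => coulomb_y F x) rho) with (Derive (coulomb_y F) rho).
rewrite (is_derive_unique _ _ _ a). unfold Psi_slope, coulomb_Psi. field. lra.
Qed.

(** rho Psi F^2, written without dividing by F so that it makes sense at zeros of F. *)
Definition turan_energy (L eta : R) (F : R -> R) (rho : R) : R :=
  rho * coulomb_q L eta rho * F rho ^ 2 + rho * Derive F rho ^ 2 - F rho * Derive F rho.

Lemma turan_energy_Psi L eta F rho : 0 < rho -> F rho <> 0 ->
  turan_energy L eta F rho = rho * F rho ^ 2 * coulomb_Psi L eta F rho.
Proof.
intros hr hn. unfold turan_energy, coulomb_Psi, coulomb_y, coulomb_q. field. lra.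
Qed.

Lemma is_derive_turan_energy {L eta F} (W : coulomb_wave L eta F) (rho : R) :
  0 < rho -> is_derive (turan_energy L eta F) rho (2 * (1 - eta / rho) * F rho ^ 2).
Proof.
intros hr. assert (a1 := wave_derive _ _ _ W rho hr). assert (a2 := wave_derive2 _ _ _ W rho hr).
unfold turan_energy, coulomb_q.
auto_derive. { repeat split; try lra; try nra; eexists; try exact a1; exact a2. }
change (Derive (fun x => Derive F x) rho) with (Derive (Derive F) rho).
change (Derive (fun x => F x) rho) with (Derive F rho).
rewrite (is_derive_unique _ _ _ a2). unfold coulomb_q. field. lra.
Qed.

(** The energy equals s F'(s)^2 > 0 at a zero s and increases beyond eta. *)
Lemma turan_energy_pos {L eta F} (W : coulomb_wave L eta F) (s rho : R) :
  eta <= s -> F s = 0 -> s <= rho -> 0 < turan_energy L eta F rho.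
Proof.
intros hs Fs hr. assert (heta := wave_eta _ _ _ W).
assert (h0 : 0 < turan_energy L eta F s).
{ unfold turan_energy. rewrite Fs. assert (a := wave_no_double_zero W s ltac:(lra) Fs).
  assert (0 < Derive F s ^ 2) by (apply pow2_gt_0, a).
  replace (s * coulomb_q L eta s * 0 ^ 2 + s * Derive F s ^ 2 - 0 * Derive F s)
    with (s * Derive F s ^ 2) by ring. apply Rmult_lt_0_compat; lra. }
destruct (Req_dec rho s) as [->|hne]; [exact h0|].
destruct (is_derive_MVT (turan_energy L eta F) (fun t => 2 * (1 - eta / t) * F t ^ 2) s rho)
  as (c & hc & ec); [lra| |].
- intros t ht. apply (is_derive_turan_energy W). lra.
- assert (eta / c <= 1) by (apply Rle_div_l; lra).
  assert (0 <= 2 * (1 - eta / c) * F c ^ 2) by (apply Rmult_le_pos; [lra|apply pow2_ge_0]).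
  assert (0 <= 2 * (1 - eta / c) * F c ^ 2 * (rho - s)) by (apply Rmult_le_pos; lra). lra.
Qed.

(** Beyond 2 eta, where all positive zeros lie, the energy increases and the estimate of
    [Psi_comparison] applies. *)
Definition arch (eta : R) (F : R -> R) (p r : R) : Prop :=
  2 * eta < p /\ F p = 0 /\ next_zero F p r.

Lemma arch_pos {L eta F} (W : coulomb_wave L eta F) {p r} (A : arch eta F p r) :
  forall t, p < t < r -> 0 < t /\ 2 * eta < t /\ F t <> 0.
Proof.
intros t ht. destruct A as (hp & _ & _ & _ & hn). assert (h := wave_eta _ _ _ W).
repeat split; [lra|lra|apply hn, ht].
Qed.

Lemma arch_Psi_pos {L eta F} (W : coulomb_wave L eta F) {p r} (A : arch eta F p r) (t : R) :
  p < t < r -> 0 < coulomb_Psi L eta F t.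
Proof.
intros ht. destruct (arch_pos W A t ht) as (h1 & h2 & h3).
assert (heta := wave_eta _ _ _ W). destruct A as (hp & Fp & _).
assert (h := turan_energy_pos W p t ltac:(lra) Fp ltac:(lra)).
rewrite turan_energy_Psi in h by assumption.
assert (0 < t * F t ^ 2).
{ apply Rmult_lt_0_compat; [lra|]. apply pow2_gt_0, h3. }
nra.
Qed.

Lemma arch_y_decreasing {L eta F} (W : coulomb_wave L eta F) {p r} (A : arch eta F p r) (s t : R) :
  p < s -> s < t -> t < r -> coulomb_y F t < coulomb_y F s.
Proof.
intros h1 h2 h3.
destruct (is_derive_MVT (coulomb_y F) (fun u => - u * coulomb_Psi L eta F u) s t) as (c & hc & ec); [lra| |].
- intros u hu. destruct (arch_pos W A u) as (a & b & d); [lra|]. apply (is_derive_coulomb_y W); assumption.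
- destruct (arch_pos W A c) as (a & b & d); [lra|].
  assert (e := arch_Psi_pos W A c ltac:(lra)).
  assert (0 < c * coulomb_Psi L eta F c) by (apply Rmult_lt_0_compat; lra). nra.
Qed.

Lemma arch_slopes {L eta F} (W : coulomb_wave L eta F) {p r} (A : arch eta F p r) :
  Derive F p * Derive F r < 0.
Proof.
destruct A as (hp & Fp & hpr & Fr & hn). assert (heta := wave_eta _ _ _ W).
destruct (wave_simple_zero W p ltac:(lra) Fp) as (d & hd & sp).
destruct (wave_simple_zero W r ltac:(lra) Fr) as (d' & hd' & sr).
set (e := Rmin (Rmin d d') (r - p) / 3).
assert (he : 0 < e /\ e < d /\ e < d' /\ e < (r - p) / 2).
{ unfold e. assert (a := Rmin_l (Rmin d d') (r - p)). assert (b := Rmin_r (Rmin d d') (r - p)).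
  assert (a' := Rmin_l d d'). assert (b' := Rmin_r d d').
  assert (0 < Rmin (Rmin d d') (r - p)) by (repeat apply Rmin_glb_lt; lra). lra. }
assert (a := sp (p + e) ltac:(lra) ltac:(lra)).
assert (b := sr (r - e) ltac:(lra) ltac:(lra)).
replace (p + e - p) with e in a by ring. replace (r - e - r) with (- e) in b by ring.
assert (a' : 0 < Derive F p * F (p + e)) by nra.
assert (b' : 0 < - (Derive F r * F (r - e))) by nra.
assert (hs : 0 < F (p + e) * F (r - e)).
{ destruct (Rlt_or_le 0 (F (p + e) * F (r - e))) as [|h]; [assumption|exfalso].
  assert (n1 := hn (p + e) ltac:(lra)). assert (n2 := hn (r - e) ltac:(lra)).
  assert (hc : forall t, p + e <= t <= r - e -> continuity_pt F t).
  { intros t ht. eapply is_derive_continuity_pt, (wave_derive _ _ _ W); lra. }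
  destruct (Rtotal_order (F (p + e)) 0) as [c|[c|c]]; [|tauto|].
  - assert (0 < F (r - e)).
    { destruct (Rtotal_order (F (r - e)) 0) as [g|[g|g]]; [nra|tauto|exact g]. }
    destruct (IVT_interv F (p + e) (r - e)) as (z & hz & ez); [exact hc|lra|lra|lra|].
    apply (hn z); lra.
  - assert (F (r - e) < 0).
    { destruct (Rtotal_order (F (r - e)) 0) as [g|[g|g]]; [exact g|tauto|nra]. }
    destruct (IVT_interv (fun t => - F t) (p + e) (r - e)) as (z & hz & ez); [|lra|lra|lra|].
    + intros t ht; apply continuity_pt_opp, hc, ht.
    + apply (hn z); lra. }
destruct (Rlt_or_le (Derive F p * Derive F r) 0) as [|h]; [assumption|exfalso].
assert (h1 : 0 < (Derive F p * F (p + e)) * - (Derive F r * F (r - e))) by (apply Rmult_lt_0_compat; assumption).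
assert (h2 : 0 <= (Derive F p * Derive F r) * (F (p + e) * F (r - e))) by (apply Rmult_le_pos; lra).
nra.
Qed.

(** The intermediate value theorem for rho F' - (Y + 1/2) F, whose values at the two ends have
    opposite signs, replaces the study of the limits of y there. *)
Lemma arch_y_onto {L eta F} (W : coulomb_wave L eta F) {p r} (A : arch eta F p r) (Y : R) :
  exists t, p < t < r /\ coulomb_y F t = Y.
Proof.
assert (hs := arch_slopes W A). assert (hA := arch_pos W A).
destruct A as (hp & Fp & hpr & Fr & hn). assert (heta := wave_eta _ _ _ W).
(* the factor - F'(p) makes the value at p negative *)
set (h := fun t => - Derive F p * (t * Derive F t - (Y + 1 / 2) * F t)).
assert (hD : Derive F p <> 0) by (intros e; rewrite e in hs; lra).
assert (hD2 : 0 < Derive F p * Derive F p) by (apply Rsqr_pos_lt, hD).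
destruct (IVT_interv h p r) as (t & ht & et).
- intros t ht. eapply (is_derive_continuity_pt h t).
  assert (a1 := wave_derive _ _ _ W t ltac:(lra)). assert (a2 := wave_derive2 _ _ _ W t ltac:(lra)).
  unfold h. auto_derive; [|reflexivity]. split; [eexists; exact a2|split; [eexists; exact a1|exact I]].
- exact hpr.
- unfold h. rewrite Fp. nra.
- unfold h. rewrite Fr. nra.
- assert (et' : t * Derive F t - (Y + 1 / 2) * F t = 0) by (unfold h in et; nra).
  assert (hpt : t <> p) by (intros ->; rewrite Fp in et'; assert (p * Derive F p <> 0) by (apply Rmult_integral_contrapositive; split; lra); lra).
  assert (hrt : t <> r).
  { intros ->; rewrite Fr in et'. assert (r * Derive F r <> 0); [|lra].
    apply Rmult_integral_contrapositive; split; [lra|]. intros e; rewrite e in hs; lra. }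
  exists t. split; [lra|]. unfold coulomb_y.
  replace (t * Derive F t) with ((Y + 1 / 2) * F t) by lra. field. apply hA; lra.
Qed.

(** Since 2 (1+y) / rho = 1 / rho + 2 F'/F, the weight rho F^2 is an integrating factor:
    (rho F^2 S)' = - rho F^2 (rho Psi^2 + eta / rho^2), where S is the slope factor. Hence S
    changes sign once. *)
Lemma arch_slope_decreasing {L eta F} (W : coulomb_wave L eta F) {p r} (A : arch eta F p r) (s t : R) :
  p < s -> s < t -> t < r ->
  t * F t ^ 2 * Psi_slope L eta F t < s * F s ^ 2 * Psi_slope L eta F s.
Proof.
intros h1 h2 h3. assert (heta := wave_eta _ _ _ W).
destruct (is_derive_MVT (fun u => u * F u ^ 2 * Psi_slope L eta F u)
   (fun u => - (u * F u ^ 2 * (u * coulomb_Psi L eta F u ^ 2 + eta / u ^ 2))) s t) as (c & hc & ec); [lra| |].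
- intros u hu. destruct (arch_pos W A u) as (a & b & d); [lra|].
  assert (a1 := wave_derive _ _ _ W u a).
  assert (a2 := is_derive_coulomb_y W u a d). assert (a3 := is_derive_coulomb_Psi W u a d).
  unfold Psi_slope.
  auto_derive. { repeat split; try lra; eexists; try exact a1; try exact a2; exact a3. }
  change (Derive (fun x => F x) u) with (Derive F u).
  change (Derive (fun x => coulomb_y F x) u) with (Derive (coulomb_y F) u).
  change (Derive (fun x => coulomb_Psi L eta F x) u) with (Derive (coulomb_Psi L eta F) u).
  rewrite (is_derive_unique _ _ _ a2), (is_derive_unique _ _ _ a3).
  unfold Psi_slope. unfold coulomb_y. field. lra.
- destruct (arch_pos W A c) as (a & b & d); [lra|].
  assert (0 < c * F c ^ 2).
  { apply Rmult_lt_0_compat; [lra|]. apply pow2_gt_0, d. }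
  assert (0 < c * coulomb_Psi L eta F c ^ 2 + eta / c ^ 2).
  { apply Rplus_le_lt_0_compat; [apply Rmult_le_pos; [lra|apply pow2_ge_0]|].
    apply Rdiv_lt_0_compat; [lra|apply pow_lt; lra]. }
  assert (0 < c * F c ^ 2 * (c * coulomb_Psi L eta F c ^ 2 + eta / c ^ 2)) by (apply Rmult_lt_0_compat; assumption).
  nra.
Qed.

(** At y = 0, Psi = 1 - 2 eta/t - nu^2/t^2. The bound by 1 passes to the minimum; the sign
    places the minimum before this point, hence at a positive value of y. *)
Lemma Psi_slope_at_y0 {L eta F} (W : coulomb_wave L eta F) (t : R) :
  0 < t -> coulomb_y F t = 0 ->
  Psi_slope L eta F t < 0 /\ coulomb_Psi L eta F t < 1.
Proof.
intros ht hy. assert (heta := wave_eta _ _ _ W). assert (hL := wave_L _ _ _ W).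
assert (0 < eta / t) by (apply Rdiv_lt_0_compat; lra).
assert (0 <= (L + 1 / 2) ^ 2 / t ^ 2) by (apply Rdiv_le_0_compat; [apply pow2_ge_0|apply pow_lt; lra]).
assert (e : coulomb_Psi L eta F t = 1 - 2 * (eta / t) - (L + 1 / 2) ^ 2 / t ^ 2).
{ unfold coulomb_Psi. rewrite hy. field. lra. }
unfold Psi_slope. rewrite hy, e. lra.
Qed.

Lemma arch_slope_pos {L eta F} (W : coulomb_wave L eta F) {p r} (A : arch eta F p r) :
  exists t, p < t < r /\ 0 < Psi_slope L eta F t.
Proof.
(* this value of y makes y ^ 2 - nu ^ 2 exceed r ^ 2, so that Psi >= 1 *)
destruct (arch_y_onto W A (r + L + 1)) as (t & ht & hy).
destruct (arch_pos W A t ht) as (a & b & d).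
assert (heta := wave_eta _ _ _ W). assert (hL := wave_L _ _ _ W).
exists t. split; [exact ht|]. unfold Psi_slope.
assert (h : 1 <= coulomb_Psi L eta F t).
{ unfold coulomb_Psi. rewrite hy.
  assert (2 * eta / t <= 1) by (apply Rle_div_l; lra).
  assert (1 <= ((r + L + 1) ^ 2 - (L + 1 / 2) ^ 2) / t ^ 2); [|lra].
  apply Rle_div_r; [apply Rlt_gt, pow_lt; lra|]. nra. }
assert (0 < eta / t) by (apply Rdiv_lt_0_compat; lra). rewrite hy. nra.
Qed.

Definition strict_min_on (f : R -> R) (p r a : R) : Prop :=
  p < a < r /\ forall t, p < t < r -> t <> a -> f a < f t.

(** The weighted slope is strictly decreasing and takes both signs, so Psi decreases up to
    its unique zero and increases afterwards. *)
Lemma arch_minimum {L eta F} (W : coulomb_wave L eta F) {p r} (A : arch eta F p r) :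
  exists a, strict_min_on (coulomb_Psi L eta F) p r a /\
    forall t, p < t < r -> is_derive (coulomb_Psi L eta F) t 0 <-> t = a.
Proof.
destruct (arch_slope_pos W A) as (s & hs & Ps).
destruct (arch_y_onto W A 0) as (u & hu & hy).
destruct (Psi_slope_at_y0 W u ltac:(apply (arch_pos W A); lra) hy) as (Pu & _).
set (Q := fun t => t * F t ^ 2 * Psi_slope L eta F t).
assert (hw : forall t, p < t < r -> 0 < t * F t ^ 2).
{ intros t ht. destruct (arch_pos W A t ht) as (a & b & d).
  apply Rmult_lt_0_compat; [lra|]. apply pow2_gt_0, d. }
assert (hQ : forall x y, p < x -> x < y -> y < r -> Q y < Q x) by apply (arch_slope_decreasing W A).
assert (Qs : 0 < Q s) by (apply Rmult_lt_0_compat; [apply hw|]; assumption).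
assert (Qu : Q u < 0) by (assert (a := hw u hu); unfold Q; nra).
assert (hsu : s < u).
{ destruct (Rtotal_order s u) as [h|[h|h]]; [exact h|subst; lra|].
  assert (a := hQ u s ltac:(lra) h ltac:(lra)). lra. }
assert (hcont : forall t, p < t < r -> continuity_pt Q t).
{ intros t ht. destruct (arch_pos W A t ht) as (a & b & d).
  assert (a1 := wave_derive _ _ _ W t a).
  assert (a2 := is_derive_coulomb_y W t a d). assert (a3 := is_derive_coulomb_Psi W t a d).
  eapply (is_derive_continuity_pt Q t). unfold Q, Psi_slope. auto_derive; [|reflexivity].
  repeat split; try lra; eexists; try exact a1; try exact a2; exact a3. }
destruct (IVT_interv (fun t => - Q t) s u) as (a & ha & ea); [|lra|lra|lra|].
{ intros t ht. apply continuity_pt_opp, hcont. lra. }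
assert (Qa : Q a = 0) by lra.
assert (hP : forall t, p < t < r -> (t < a -> 0 < Psi_slope L eta F t) /\ (a < t -> Psi_slope L eta F t < 0)).
{ intros t ht. assert (b := hw t ht). split; intros h.
  - assert (c := hQ t a ltac:(lra) h ltac:(lra)). rewrite Qa in c. unfold Q in c. nra.
  - assert (c := hQ a t ltac:(lra) h ltac:(lra)). rewrite Qa in c. unfold Q in c. nra. }
assert (hd : forall t, p < t < r -> is_derive (coulomb_Psi L eta F) t (- (2 / t) * Psi_slope L eta F t)).
{ intros t ht. destruct (arch_pos W A t ht) as (b & _ & d). apply (is_derive_coulomb_Psi W); assumption. }
assert (h2 : forall t, p < t < r -> 0 < 2 / t).
{ intros t ht. destruct (arch_pos W A t ht) as (b & _). apply Rdiv_lt_0_compat; lra. }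
exists a. split.
- split; [lra|]. intros t ht hne. destruct (Rtotal_order t a) as [h|[h|h]]; [|tauto|].
  + destruct (is_derive_MVT _ _ t a h (fun v hv => hd v ltac:(lra))) as (c & hc & ec).
    assert (b := proj1 (hP c ltac:(lra)) ltac:(lra)). assert (b' := h2 c ltac:(lra)).
    assert (0 < 2 / c * Psi_slope L eta F c) by (apply Rmult_lt_0_compat; lra). nra.
  + destruct (is_derive_MVT _ _ a t h (fun v hv => hd v ltac:(lra))) as (c & hc & ec).
    assert (b := proj2 (hP c ltac:(lra)) ltac:(lra)). assert (b' := h2 c ltac:(lra)).
    assert (0 < 2 / c * - Psi_slope L eta F c) by (apply Rmult_lt_0_compat; lra). nra.
- intros t ht. assert (b' := h2 t ht). split.
  + intros h0. apply is_derive_unique in h0. rewrite (is_derive_unique _ _ _ (hd t ht)) in h0.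
    destruct (hP t ht) as (b1 & b2). destruct (Rtotal_order t a) as [h|[h|h]]; [|exact h|].
    * specialize (b1 h). nra.
    * specialize (b2 h). nra.
  + intros ->. evar_last. apply hd; lra.
    assert (b := hw a ltac:(lra)). unfold Q in Qa. apply Rmult_integral in Qa. destruct Qa as [c|c]; [lra|rewrite c; ring].
Qed.

Lemma arch_critical {L eta F} (W : coulomb_wave L eta F) {p r} (A : arch eta F p r) (a : R) :
  p < a < r -> is_derive (coulomb_Psi L eta F) a 0 ->
  0 < coulomb_y F a /\ Psi_slope L eta F a = 0.
Proof.
intros ha h0.
assert (hP : forall t, p < t < r -> is_derive (coulomb_Psi L eta F) t (- (2 / t) * Psi_slope L eta F t)).
{ intros t ht. destruct (arch_pos W A t ht) as (b & _ & d). apply (is_derive_coulomb_Psi W); assumption. }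
assert (hpa : 0 < a) by apply (arch_pos W A a ha).
apply is_derive_unique in h0. rewrite (is_derive_unique _ _ _ (hP a ha)) in h0.
assert (0 < 2 / a) by (apply Rdiv_lt_0_compat; lra).
assert (Pa : Psi_slope L eta F a = 0) by nra.
split; [|exact Pa].
destruct (arch_y_onto W A 0) as (u & hu & hy).
destruct (arch_pos W A u hu) as (hu0 & _ & Fu).
destruct (Psi_slope_at_y0 W u hu0 hy) as (Pu & _).
rewrite <- hy. apply (arch_y_decreasing W A); [lra| |lra].
destruct (Rtotal_order a u) as [h|[h|h]]; [exact h|subst; lra|].
exfalso. assert (c := arch_slope_decreasing W A u a ltac:(lra) h ltac:(lra)). rewrite Pa in c.
assert (0 < u * F u ^ 2) by (apply Rmult_lt_0_compat; [lra|]; apply pow2_gt_0, Fu).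
nra.
Qed.

(** The lower bound drops the nonnegative term y^2 / a^2; it tends to 1 as the arch moves to
    infinity. *)
Lemma arch_min_bounds {L eta F} (W : coulomb_wave L eta F) {p r} (A : arch eta F p r) (a : R) :
  strict_min_on (coulomb_Psi L eta F) p r a ->
  0 < coulomb_Psi L eta F a < 1 /\
  1 - 2 * eta / p - (L + 1 / 2) ^ 2 / p ^ 2 <= coulomb_Psi L eta F a.
Proof.
intros [ha hm]. assert (heta := wave_eta _ _ _ W). split; [split|].
- apply (arch_Psi_pos W A _ ha).
- destruct (arch_y_onto W A 0) as (u & hu & hy).
  destruct (Psi_slope_at_y0 W u ltac:(apply (arch_pos W A); lra) hy) as (_ & Pu).
  destruct (Req_dec u a) as [->|hne]; [exact Pu|]. assert (c := hm u hu hne). lra.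
- destruct (arch_pos W A a ha) as (h1 & h2 & h3). destruct A as (hp & _).
  assert (2 * eta / a <= 2 * eta / p).
  { apply Rmult_le_compat_l; [lra|]. apply Rinv_le_contravar; lra. }
  assert ((L + 1 / 2) ^ 2 / a ^ 2 <= (L + 1 / 2) ^ 2 / p ^ 2).
  { apply Rmult_le_compat_l; [apply pow2_ge_0|].
    apply Rinv_le_contravar; [apply pow_lt; lra|apply pow_incr; lra]. }
  assert (0 <= coulomb_y F a ^ 2 / a ^ 2) by (apply Rdiv_le_0_compat; [apply pow2_ge_0|apply pow_lt; lra]).
  replace (coulomb_Psi L eta F a) with
    (1 - 2 * eta / a + coulomb_y F a ^ 2 / a ^ 2 - (L + 1 / 2) ^ 2 / a ^ 2); [lra|].
  unfold coulomb_Psi. field. lra.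
Qed.

(** * Comparison of successive minima *)

(** The expression compared is Psi as a function of rho at a fixed value y, under the critical
    point equation at s. As a quadratic 1 - 2 eta v + c v^2 in v = 1/rho, with
    c = y^2 - nu^2, it is decreasing in v when c <= 0. When c > 0, the critical point
    equation keeps c small enough for the values of v up to 1 / (2 eta). *)
Lemma Psi_comparison (eta nu y s t : R) :
  0 < eta -> 1 / 2 <= nu -> 0 < y -> 2 * eta < t -> t < s ->
  (1 + y) * (1 - 2 * eta / s + (y ^ 2 - nu ^ 2) / s ^ 2) - 1 + eta / s = 0 ->
  1 - 2 * eta / t + (y ^ 2 - nu ^ 2) / t ^ 2 < 1 - 2 * eta / s + (y ^ 2 - nu ^ 2) / s ^ 2.
Proof.
intros heta hnu hy ht hs hcrit.
set (c := y ^ 2 - nu ^ 2) in *. set (u := / s). set (v := / t).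
assert (hu : 0 < u) by (apply Rinv_0_lt_compat; lra).
assert (huv : u < v) by (apply Rinv_lt_contravar; [nra|lra]).
assert (hv : 2 * eta * v < 1) by (unfold v; apply Rlt_div_l; lra).
assert (hcrit' : y * (1 - 2 * eta * u) + (1 + y) * c * u ^ 2 = eta * u).
{ unfold u. rewrite pow_inv. unfold Rdiv in hcrit. nra. }
replace (2 * eta / t) with (2 * eta * v) by reflexivity.
replace (2 * eta / s) with (2 * eta * u) by reflexivity.
replace (c / t ^ 2) with (c * v ^ 2) by (unfold v; rewrite pow_inv; reflexivity).
replace (c / s ^ 2) with (c * u ^ 2) by (unfold u; rewrite pow_inv; reflexivity).
(* with u = 1/s < v = 1/t, the difference of the two sides is
   (v - u) (2 eta - c (u + v)) *)
enough (c * (u + v) < 2 * eta) by nra.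
destruct (Rle_or_lt c 0) as [hc|hc]; [nra|].
(* c > 0 forces y > nu >= 1/2; then c u < 2 eta / 3 and c v < 4 eta / 3 *)
assert (hy2 : 1 / 2 < y) by (unfold c in hc; nra).
assert (h1 : y < eta * u * (1 + 2 * y)).
{ assert (0 < (1 + y) * c * u ^ 2) by (apply Rmult_lt_0_compat; [nra|apply pow_lt; lra]). nra. }
assert (h2 : (1 + y) * (c * u) <= eta).
{ assert (0 <= y * (1 - 2 * eta * u)) by (apply Rmult_le_pos; nra).
  apply Rmult_le_reg_r with u; [exact hu|]. nra. }
assert (h3 : c * u < 2 / 3 * eta).
{ assert (0 < c * u) by (apply Rmult_lt_0_compat; lra). nra. }
assert (h4 : c * y * (1 + y) <= eta ^ 2 * (1 + 2 * y)).
{ assert (c * (1 + y) * y <= c * (1 + y) * (eta * u * (1 + 2 * y))) by (apply Rmult_le_compat_l; nra).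
  assert ((1 + y) * (c * u) * (eta * (1 + 2 * y)) <= eta * (eta * (1 + 2 * y))) by (apply Rmult_le_compat_r; nra).
  nra. }
assert (h5 : 3 * c < 8 * eta ^ 2).
{ assert (0 < y * (1 + y)) by nra.
  apply Rmult_lt_reg_r with (y * (1 + y)); [assumption|].
  assert (3 * (1 + 2 * y) < 8 * (y * (1 + y))) by nra.
  assert (0 < eta ^ 2) by nra. nra. }
assert (h6 : c * v < 4 / 3 * eta).
{ apply Rmult_lt_reg_l with (2 * eta); [lra|].
  assert (c * (2 * eta * v) < c * 1) by (apply Rmult_lt_compat_l; lra). nra. }
lra.
Qed.

(** y maps each arch onto the whole line, so the value of y at the minimum of the later
    arch is also taken at a smaller rho in the earlier arch. There Psi is smaller, and the minimum
    of the earlier arch is at most that. *)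
Lemma arch_min_increasing {L eta F} (W : coulomb_wave L eta F) {p r p' r'}
  (A : arch eta F p r) (A' : arch eta F p' r') (a a' : R) :
  r <= p' ->
  strict_min_on (coulomb_Psi L eta F) p r a ->
  p' < a' < r' -> is_derive (coulomb_Psi L eta F) a' 0 ->
  coulomb_Psi L eta F a < coulomb_Psi L eta F a'.
Proof.
intros hrp [ha hm] ha' h0.
destruct (arch_critical W A' a' ha' h0) as (hy & hP).
destruct (arch_y_onto W A (coulomb_y F a')) as (t & ht & hyt).
destruct (arch_pos W A t ht) as (h1 & h2 & h3).
assert (hle : coulomb_Psi L eta F a <= coulomb_Psi L eta F t).
{ destruct (Req_dec t a) as [->|hne]; [lra|left; apply hm; assumption]. }
apply Rle_lt_trans with (1 := hle).
unfold coulomb_Psi. rewrite hyt.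
apply Psi_comparison; [apply (wave_eta _ _ _ W)|assert (b := wave_L _ _ _ W); lra|exact hy|exact h2|lra|exact hP].
Qed.

Lemma Psi_lower_bound_lim (L eta : R) (x : nat -> R) :
  is_lim_seq x p_infty ->
  is_lim_seq (fun n => 1 - 2 * eta / x n - (L + 1 / 2) ^ 2 / x n ^ 2) 1.
Proof.
intros hx.
assert (h := is_lim_seq_inv x p_infty hx ltac:(discriminate)). simpl in h.
set (f := fun u => 1 - 2 * eta * u - (L + 1 / 2) ^ 2 * u ^ 2).
assert (hf : is_lim_seq (fun n => f (/ x n)) (f 0)).
{ apply is_lim_seq_continuous; [|exact h]. apply continuity_pt_filterlim, (ex_derive_continuous f).
  unfold f. auto_derive. exact I. }
replace (Finite 1) with (Finite (f 0)) by (unfold f; f_equal; ring).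
apply is_lim_seq_ext with (2 := hf). intros n. unfold f, Rdiv. rewrite pow_inv. ring.
Qed.

Theorem theorem3 (L eta : R) (Fm F Fp : R -> R)
  (hL : 0 <= L) (heta : 0 < eta)
  (hFm : regular_coulomb (L - 1) eta Fm)
  (hF : regular_coulomb L eta F)
  (hFp : regular_coulomb (L + 1) eta Fp) :
  exists x a : nat -> R,
    positive_zeros F x /\
    (forall n : nat, (1 <= n)%nat ->
       x n < a n < x (S n) /\
       (forall rho, x n < rho < x (S n) ->
          is_derive (coulomb_Psi L eta F) rho 0 <-> rho = a n)) /\
    let b := fun n : nat => coulomb_Psi L eta F (a n) in
    (forall n : nat, (1 <= n)%nat -> 0 < b n /\ b n < b (S n) /\ b n < 1) /\
    is_lim_seq b 1 /\
    (forall (n : nat) (rho : R), (1 <= n)%nat -> x n < rho < x (S n) ->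
       turan_coulomb L eta Fm F Fp rho
         = L * (L + 1) * coulomb_Psi L eta F rho * F rho ^ 2 /\
       turan_coulomb L eta Fm F Fp rho >= L * (L + 1) * b n * F rho ^ 2 /\
       (turan_coulomb L eta Fm F Fp rho = L * (L + 1) * b n * F rho ^ 2
          <-> rho = a n \/ L = 0)) /\
    (forall (n : nat) (k : R), (1 <= n)%nat ->
       (forall rho, x n < rho < x (S n) ->
          turan_coulomb L eta Fm F Fp rho >= k * F rho ^ 2) ->
       k <= L * (L + 1) * b n) /\
    (forall n : nat, (1 <= n)%nat ->
       L * (L + 1) * b n <= L * (L + 1) * b (S n) /\
       (0 < L -> L * (L + 1) * b n < L * (L + 1) * b (S n))) /\
    is_lim_seq (fun n : nat => L * (L + 1) * b n) (L * (L + 1)).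
Proof.
assert (W := regular_coulomb_wave L eta F hL heta hF).
destruct (wave_zero_sequence W) as (x & x0 & hx).
assert (hA : forall n, (1 <= n)%nat -> arch eta F (x n) (x (S n))).
{ intros [|n] hn; [lia|]. split; [apply (zero_sequence_beyond W x x0 hx)|split; [apply (hx n)|apply hx]]. }
destruct (functional_choice (fun n a => (1 <= n)%nat ->
    strict_min_on (coulomb_Psi L eta F) (x n) (x (S n)) a /\
    forall t, x n < t < x (S n) -> is_derive (coulomb_Psi L eta F) t 0 <-> t = a)) as (a & ha).
{ intros [|n]; [exists 0; lia|]. destruct (arch_minimum W (hA (S n) ltac:(lia))) as (a & h). exists a; auto. }
assert (hturan : forall n rho, (1 <= n)%nat -> x n < rho < x (S n) -> 0 < F rho ^ 2 /\
   turan_coulomb L eta Fm F Fp rho = L * (L + 1) * coulomb_Psi L eta F rho * F rho ^ 2).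
{ intros n rho hn hr. destruct (arch_pos W (hA n hn) rho hr) as (h1 & _ & h2). split.
  - apply pow2_gt_0, h2.
  - apply coulomb_turan_Psi; assumption. }
exists x, a. split; [apply (zero_sequence_positive_zeros W x x0 hx)|].
split; [intros n hn; destruct (ha n hn) as ((h1 & _) & h2); auto|].
intros b.
assert (hb : forall n, (1 <= n)%nat -> 0 < b n /\ b n < b (S n) /\ b n < 1).
{ intros n hn. destruct (ha n hn) as (hm & hc). destruct (ha (S n) ltac:(lia)) as ((hm' & _) & hc').
  destruct (arch_min_bounds W (hA n hn) (a n) hm) as (h1 & _).
  split; [apply h1|split; [|apply h1]].
  apply (arch_min_increasing W (hA n hn) (hA (S n) ltac:(lia))); [lra|exact hm|exact hm'|].
  apply hc'; auto. }
assert (hinf : is_lim_seq x p_infty).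
{ apply is_lim_seq_p_infty_Reals. intros M.
  destruct (zero_sequence_unbounded W x x0 hx M) as (N & hN). exists N. intros n hn.
  apply Rlt_le_trans with (1 := hN). clear hN.
  induction hn as [|n hn IH]; [lra|]. destruct (hx n). lra. }
assert (hlim : is_lim_seq b 1).
{ apply is_lim_seq_incr_1.
  apply is_lim_seq_le_le with (u := fun n => 1 - 2 * eta / x (S n) - (L + 1 / 2) ^ 2 / x (S n) ^ 2) (w := fun _ => 1).
  - intros n. destruct (ha (S n) ltac:(lia)) as (hm & _).
    destruct (arch_min_bounds W (hA (S n) ltac:(lia)) (a (S n)) hm) as (h1 & h2). split; [exact h2|].
    left; apply h1.
  - apply (Psi_lower_bound_lim L eta (fun n => x (S n))). apply (is_lim_seq_incr_1 x). exact hinf.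
  - apply is_lim_seq_const. }
assert (hLL : 0 <= L * (L + 1)) by nra.
split; [exact hb|split; [exact hlim|]].
split.
{ intros n rho hn hr. destruct (hturan n rho hn hr) as (h1 & h2). destruct (ha n hn) as ((_ & hmin) & _).
  split; [exact h2|]. rewrite h2.
  destruct (Req_dec rho (a n)) as [->|hne].
  - split; [unfold b; lra|]. split; [auto|reflexivity].
  - assert (h3 := hmin rho hr hne). fold (b n) in h3.
    assert (h4 : 0 < (coulomb_Psi L eta F rho - b n) * F rho ^ 2) by (apply Rmult_lt_0_compat; lra).
    split; [nra|]. split.
    + intros e. right. assert (e' : L * (L + 1) * ((coulomb_Psi L eta F rho - b n) * F rho ^ 2) = 0) by lra.
      apply Rmult_integral in e'. destruct e' as [e'|e']; [|lra].
      apply Rmult_integral in e'. destruct e'; lra.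
    + intros [e| ->]; [contradiction|ring]. }
split.
{ intros n k hn hk. destruct (ha n hn) as ((hr & _) & _).
  destruct (hturan n (a n) hn hr) as (h1 & h2). specialize (hk (a n) hr). rewrite h2 in hk. fold (b n) in hk.
  apply Rmult_le_reg_r with (F (a n) ^ 2); lra. }
split.
{ intros n hn. destruct (hb n hn) as (_ & h & _). split.
  - apply Rmult_le_compat_l; lra.
  - intros h0. apply Rmult_lt_compat_l; [nra|exact h]. }
replace (Finite (L * (L + 1))) with (Rbar_mult (L * (L + 1)) 1) by (simpl; f_equal; ring).
apply is_lim_seq_scal_l. exact hlim.
Qed.
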